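(* Let $\alpha\in\mathbb{J}$ and assume $P=\{P_1,\ldots,P_n\}$ and $\tilde P=\{\tilde P_1,\ldots,\tilde P_n\}$ belong to $\mathscr{P}_{\beta_1,\ldots,\beta_n,R}$, and define $|P-\tilde P|_{\alpha,\beta_1,\ldots,\beta_n}=\max_{i=1,\ldots,n}\|P_i-\tilde P_i\|_{\mathcal{L}(X^\alpha,X^{\beta_i})}$. Also, assume $\gamma\in\mathcal{E}_\alpha$ and $u_0,\tilde u_0\in X^\gamma$ are such that $\|u_0\|_\gamma,\|\tilde u_0\|_\gamma\le\mathscr{R}$. Then for $\gamma'\in\mathcal{R}_{\beta_1,\ldots,\beta_n}$ such that $\gamma\stackrel{S(t)}{\dashrightarrow}\gamma'$, and $T>0$, we have, for $0<t\le T$, $$\|S_P(t)u_0-S_{\tilde P}(t)\tilde u_0\|_{\gamma'}\le\frac{M_0}{t^{d(\gamma',\gamma)}}\Big(\|u_0-\tilde u_0\|_\gamma+|P-\tilde P|_{\alpha,\beta_1,\ldots,\beta_n}\Big)$$ and $$\|S_P(t)-S_{\tilde P}(t)\|_{\mathcal{L}(X^\gamma,X^{\gamma'})}\le\frac{M_1}{t^{d(\gamma',\gamma)}}|P-\tilde P|_{\alpha,\beta_1,\ldots,\beta_n},$$ where $M_0$ and $M_1$ depend on $\alpha,\beta_i,\gamma,\gamma',R$ and $T$. Additionally $M_0$ depends on $\mathscr{R}$.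
   Context: Scale of spaces: $\mathbb{J}$ is a set of indices and $\{X^\gamma\}_{\gamma\in\mathbb{J}}$ a family of Banach spaces (norms $\|\cdot\|_\gamma$) that is topologically consistent: if a sequence in $X^\gamma\cap X^{\tilde\gamma}$ converges in both spaces, the limits coincide. A map $\mathtt{r}:\mathbb{J}\to\mathbb{R}$ (regularity index) is given and $d(\tilde\gamma,\gamma):=\mathtt{r}(\tilde\gamma)-\mathtt{r}(\gamma)$. $\{S(t)\}_{t\ge0}$ is a (fixed) family of linear operators with $S(0)=I$ defined consistently on the spaces of the scale (if $u_0\in X^\gamma\cap X^{\tilde\gamma}$, the values of $S(t)u_0$ in the two spaces coincide). Smoothing: $\gamma\stackrel{S(t)}{\dashrightarrow}\tilde\gamma$ means that $d(\tilde\gamma,\gamma)\ge0$ and for any $T>0$ there is a constant $M=M(\gamma,\tilde\gamma,T)$ (nondecreasing in $T$) with $\|S(t)\|_{\mathcal{L}(X^\gamma,X^{\tilde\gamma})}\le M t^{-d(\tilde\gamma,\gamma)}$ for $0<t\le T$. $\gamma\stackrel{S(t)}{\leadsto}\tilde\gamma$ means that in addition $(0,\infty)\ni t\mapsto S(t)u_0\in X^{\tilde\gamma}$ is continuous for each $u_0\in X^\gamma$. Perturbations: for fixed $\alpha\in\mathbb{J}$, $R>0$ and $\beta\in\mathbb{J}$, $\mathscr{P}_{\beta,R}$ is the set of $P\in\mathcal{L}(X^\alpha,X^\beta)$ with $\|P\|_{\mathcal{L}(X^\alpha,X^\beta)}\le R$, where $\alpha,\beta$ satisfy $0\le d(\alpha,\beta)<1$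 and $\beta\stackrel{S(t)}{\leadsto}\alpha$. $P=\{P_1,\ldots,P_n\}\in\mathscr{P}_{\beta_1,\ldots,\beta_n,R}$ means $P_i\in\mathscr{P}_{\beta_i,R}$ for each $i$. Index sets: $\mathcal{E}_\alpha:=\{\gamma\in\mathbb{J}:\mathtt{r}(\gamma)\in(\mathtt{r}(\alpha)-1,\mathtt{r}(\alpha)]\text{ and }\gamma\stackrel{S(t)}{\leadsto}\alpha\}$; $\mathcal{R}_\beta:=\{\gamma'\in\mathbb{J}:\mathtt{r}(\gamma')\in[\mathtt{r}(\beta),\mathtt{r}(\beta)+1)\text{ and }\beta\stackrel{S(t)}{\leadsto}\gamma'\}$; $\mathcal{R}_{\beta_1,\ldots,\beta_n}:=\bigcap_i\mathcal{R}_{\beta_i}$. Perturbed family: $\mathcal{L}^\infty_{\alpha,\varepsilon}$ is the set of strongly measurable $\varphi:(0,\infty)\to X^\alpha$ with $\sup_{t\in(0,T]}t^\varepsilon\|\varphi(t)\|_\alpha<\infty$ for every $T>0$. For $\gamma\in\mathcal{E}_\alpha$ and $u_0\in X^\gamma$ there is a unique $u\in\mathcal{L}^\infty_{\alpha,d(\alpha,\gamma)}$ with $u(t)=S(t)u_0+\sum_{i=1}^n\int_0^tS(t-\tau)P_iu(\tau)\,d\tau$ for all $t>0$; $S_P(t)u_0:=u(t)$ for $t>0$ and $S_P(0)u_0:=u_0$. *)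

(* Defs.v *)
From HB Require Import structures.
From mathcomp Require Import all_boot all_order all_algebra.
From mathcomp Require Import all_classical all_reals all_analysis.

Set Implicit Arguments.
Unset Strict Implicit.
Unset Printing Implicit Defensive.

Import Order.TTheory GRing.Theory Num.Theory.
Import numFieldNormedType.Exports.

Local Open Scope classical_set_scope.
Local Open Scope ring_scope.

(** * Bochner integral with respect to Lebesgue measure *)

Section Bochner.
Variables (R : realType) (V : normedModType R).
Local Notation mu := (@lebesgue_measure R).
Implicit Types (D : set R) (f s : R -> V).

Definition simple_fun s : Prop :=
  finite_set (range s) /\ forall x, measurable (s @^-1` [set x]).

Definition strongly_measurable D f : Prop :=
  exists s : nat -> R -> V, (forall k, simple_fun (s k)) /\
    {ae mu, forall t, D t -> s ^~ t @ \oo --> f t}.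

Definition simple_integrable D s : Prop :=
  simple_fun s /\
  forall x, x != 0 -> (mu (D `&` s @^-1` [set x]) < +oo)%E.

Definition simple_integral D s : V :=
  \sum_(x \in range s) fine (mu (D `&` s @^-1` [set x])) *: x.

(* [f] is Bochner integrable on [D] with integral [v].  The almost everywhere
   convergence makes the integrand of the third clause almost everywhere equal
   to a Borel function, so that its [\int] is the usual Lebesgue integral even
   when [f] itself is only Lebesgue measurable. *)
Definition is_bochner D f (v : V) : Prop :=
  exists s : nat -> R -> V,
    [/\ forall k, simple_integrable D (s k),
        {ae mu, forall t, D t -> s ^~ t @ \oo --> f t},
        (fun k => \int[mu]_(t in D) `|f t - s k t|%:E)%E @ \oo --> 0%E &
        (fun k => simple_integral D (s k)) @ \oo --> v].

(* Equal to [0] if [f] is not Bochner integrable on [D]. *)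
Definition bochner D f : V := xget 0 [set v | is_bochner D f v].

End Bochner.

(** * Operator norms *)

(* The codomain is an arbitrary type [W] with an extended-real valued norm [N];
   the value [+oo] means that [f] is not a bounded operator. *)
Definition op_norm (R : realType) (V : normedModType R) (W : Type)
    (N : W -> \bar R) (f : V -> W) : \bar R :=
  ereal_sup [set N (f x) | x in [set x : V | `|x| <= 1]].

(* The norm of [L(V, W)] for normed spaces [V] and [W]. *)
Definition bop_norm (R : realType) (V W : normedModType R) (f : V -> W) :
    \bar R :=
  op_norm (fun y => `|y|%:E) f.

(** * Scales of Banach spaces *)

(* Elements of different spaces of the scale are compared in an ambient vector
   space (no topology), into which every space is linearly embedded. An element
   of the intersection of two spaces is thus a pair [x : bspace g],
   [y : bspace g'] with [emb g x = emb g' y]. *)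
Record banach_scale (R : realType) := BanachScale {
  idx : Type;
  ambient : lmodType R;
  bspace : idx -> completeNormedModType R;
  emb : forall g, {linear bspace g -> ambient};
  emb_inj : forall g, injective (emb g);
  topologically_consistent : forall g g' (x : nat -> bspace g)
      (y : nat -> bspace g') (lx : bspace g) (ly : bspace g'),
    (forall k, emb g (x k) = emb g' (y k)) ->
    x @ \oo --> lx -> y @ \oo --> ly -> emb g lx = emb g' ly;
  reg : idx -> R
}.

Section Scale.
Variables (R : realType) (X : banach_scale R).
Implicit Types (g a b : idx X).

Definition dreg g' g : R := reg g' - reg g.

(* The norm of [X^g] on the ambient space: it is [+oo] outside of [X^g], since
   [ereal_inf set0 = +oo], and otherwise the set is a singleton. *)
Definition scale_norm g (e : ambient X) : \bar R :=
  ereal_inf [set `|x|%:E | x in emb g @^-1` [set e]].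

(* The element of [X^g] represented by [e], or [0] if there is none. *)
Definition in_space g (e : ambient X) : bspace g :=
  xget 0 (emb g @^-1` [set e]).

(* [S t g] is the operator [S(t)] on [X^g]. Its values are only required to lie
   in the ambient space; that they lie in a given space of the scale is part of
   the smoothing hypotheses. Only [t >= 0] is relevant. *)
Record op_family := OpFamily {
  op_at :> R -> forall g, {linear bspace g -> ambient X};
  op_at0 : forall g (x : bspace g), op_at 0 g x = emb g x;
  op_consistent : forall t g g' (x : bspace g) (y : bspace g'), 0 <= t ->
    emb g x = emb g' y -> op_at t g x = op_at t g' y
}.

Variable S : op_family.

(* The bound includes that [S(t)] maps [X^g] into [X^g'] for all [t > 0]. *)
Definition smoothing g g' : Prop :=
  0 <= dreg g' g /\
  exists M : R -> R,
    (forall T1 T2, 0 < T1 -> T1 <= T2 -> M T1 <= M T2) /\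
    forall T t, 0 < t -> t <= T ->
      (op_norm (scale_norm g') (S t g) <= (M T * t `^ (- dreg g' g))%:E)%E.

Definition smoothing_cont g g' : Prop :=
  smoothing g g' /\
  forall u0 : bspace g,
    {within `]0, +oo[, continuous (fun t : R => in_space g' (S t g u0))}.

Definition admissible a b : Prop :=
  (0 <= dreg a b < 1) /\ smoothing_cont b a.

Definition perturbation a b (R0 : R) (P : {linear bspace a -> bspace b}) :
    Prop :=
  admissible a b /\ (bop_norm P <= R0%:E)%E.

Definition perturbations n a (b : 'I_n -> idx X) (R0 : R)
    (P : forall i, {linear bspace a -> bspace (b i)}) : Prop :=
  forall i, perturbation R0 (P i).

Definition pert_dist n a (b : 'I_n -> idx X)
    (P Q : forall i, {linear bspace a -> bspace (b i)}) : \bar R :=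
  \big[maxe/0%E]_(i < n) bop_norm (fun x => P i x - Q i x).

Definition E_set a : set (idx X) :=
  [set g | (reg a - 1 < reg g <= reg a) /\ smoothing_cont g a].

Definition R_set b : set (idx X) :=
  [set g' | (reg b <= reg g' < reg b + 1) /\ smoothing_cont b g'].

Definition R_sets n (b : 'I_n -> idx X) : set (idx X) :=
  \bigcap_(i in [set: 'I_n]) R_set (b i).

(* Functions on [(0, +oo)] are represented by functions on [R] whose values at
   [t <= 0] are irrelevant. *)
Definition Linfty_loc a (eps : R) : set (R -> bspace a) :=
  [set phi | strongly_measurable `]0, +oo[ phi /\
    forall T : R, 0 < T ->
      (ereal_sup [set (t `^ eps * `|phi t|)%R%:E | t in [set t : R | (0 < t <= T)%R]] < +oo)%E].

Definition perturbed_solution n a (b : 'I_n -> idx X)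
    (P : forall i, {linear bspace a -> bspace (b i)}) g (u0 : bspace g)
    (u : R -> bspace a) : Prop :=
  Linfty_loc (dreg a g) u /\
  forall t, 0 < t ->
    u t = in_space a (S t g u0) +
      \sum_(i < n) bochner `]0, t[
        (fun tau => in_space a (S (t - tau) (b i) (P i (u tau)))).

(* [S_P(t)] on [X^g], for [t >= 0]. For [g] in [E_set a] the solution exists
   and is unique on [(0, +oo)], so that the choice made here is immaterial. *)
Definition perturbed_family n a (b : 'I_n -> idx X)
    (P : forall i, {linear bspace a -> bspace (b i)})
    (t : R) g (u0 : bspace g) : ambient X :=
  if 0 < t then
    emb a (xget (fun=> 0) [set u | perturbed_solution P u0 u] t)
  else emb g u0.

End Scale.

Arguments perturbations {R X} S {n a b} R0 P.
Arguments perturbed_family {R X} S {n a b} P t g u0.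

(* Main.v *)
Require Import Defs.
From HB Require Import structures.
From mathcomp Require Import all_boot all_order all_algebra.
From mathcomp Require Import finmap.
From mathcomp Require Import all_classical all_reals all_analysis.
From mathcomp Require Import measurable_realfun ring lra.

(** The solution of the perturbed equation satisfies the Volterra equation
    [u(t) = S(t) u0 + sum_i int_0^t S(t - x) P_i u(x) dx], whose kernels have an
    integrable singularity [(t - x)^(-p)] with [p < 1], acting on functions of
    size [x^(-q)] near [0] with [q = d(alpha, gamma) < 1].  Everything rests on
    [int_0^t (t - x)^(-p) x^(-q) dx <= B t^(1 - p - q)] and on its weighted form
    ([weighted_kernel_contraction]): measured against
    [x^(-q) exp(l x)] the integral operator has norm as small as desired on
    [(0, T]] once [l] is large.  No semigroup property is available, so the
    equation cannot be solved by time stepping; the exponential weight gives a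
    contraction on all of [(0, T]] at once.  It serves three times: for the
    existence of solutions ([volterra_solution]), for the bound of a solution by
    its initial value ([solution_bound]), and for the bound of the difference of
    two solutions in [X^alpha] ([solution_difference_bound]).

    If [u] solves the equation for [(P, u0)] and [v] for [(Q, v0)], then
    [u(t) - v(t) = S(t) (u0 - v0) + sum_i int_0^t S(t - x) y_i(x) dx] where
    [y_i = P_i u - Q_i v = P_i (u - v) + (P_i - Q_i) v] has norm at most
    [C x^(-q) (|u0 - v0| + |P - Q|)] in [X^(beta_i)], by the bounds in [X^alpha].
    Smoothing from [beta_i] to [gamma'] then bounds the integrals in [X^gamma'],
    and the exponents add up:
    [1 - d(gamma', beta_i) - q = (1 - d(alpha, beta_i)) - d(gamma', gamma)].
    The operator-norm estimate is the special case [u0 = v0] with [|u0| <= 1].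

    Two points need care with Bochner integrals.  First, the integrals must
    exist, for arbitrary strongly measurable solutions: with [x_k <= x] a
    discretisation of the time [x] and [y_k] simple functions converging to [y],
    the functions [S(t - x_k) y_k(x)] are simple and converge to
    [S(t - x) y(x)], and truncating [y_k] makes them dominated
    ([convolution_cvg_simple_data]).  Secondly, the integral taken in [X^alpha]
    must represent the same element as the one taken in [X^gamma'].  The same
    [x_k] and [y_k] serve for both spaces, so that the integrals of the simple
    functions agree, and topological consistency passes to the limit
    ([convolution_consistent]).

    The theory of the Bochner integral that is needed comes down to the dominated
    convergence of simple functions ([bochner_dominated]).  A norm [|f(t)|] is in
    general only almost everywhere equal to a Borel function, and its integral
    is then a supremum over simple functions below it; [norm_envelope] provides a
    Borel majorant with the same integral, which restores additivity and
    dominated convergence. *)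

Set Implicit Arguments.
Unset Strict Implicit.
Unset Printing Implicit Defensive.

Import Order.TTheory GRing.Theory Num.Theory.
Import numFieldNormedType.Exports.

Local Open Scope classical_set_scope.
Local Open Scope ring_scope.

(** * Functions with finitely many values *)
Section SimpleFunctions.
Variable R : realType.
Local Notation mu := (@lebesgue_measure R).

(** The values lie in an arbitrary type, so that a pair of such functions, or a
    function of one, is again of this kind; on a normed space this is
    [simple_fun]. *)
Definition fin_fun (T : Type) (s : R -> T) : Prop :=
  finite_set (range s) /\ forall x, measurable (s @^-1` [set x]).

Lemma fin_fun_preimage (T : Type) (s : R -> T) (A : set T) :
  fin_fun s -> measurable (s @^-1` A).
Proof.
move=> [fs ms].
have -> : s @^-1` A = \bigcup_(x in range s `&` A) s @^-1` [set x].
  apply/seteqP; split=> [r Ar|r [x [_ Ax] /= ->//]].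
  by exists (s r) => //; split => //; exists r.
by apply: fin_bigcup_measurable => //; exact: finite_setIl.
Qed.

Lemma fin_fun_comp (T T' : Type) (h : T -> T') (s : R -> T) :
  fin_fun s -> fin_fun (h \o s).
Proof.
move=> hs; split; last first.
  by move=> x; rewrite comp_preimage; exact: fin_fun_preimage.
rewrite (_ : range (h \o s) = h @` range s); first exact: finite_image hs.1.
by rewrite image_comp.
Qed.

Lemma fin_fun_pair (T T' : Type) (s : R -> T) (s' : R -> T') :
  fin_fun s -> fin_fun s' -> fin_fun (fun x => (s x, s' x)).
Proof.
move=> [fs ms] [fs' ms']; split.
  apply: (@sub_finite_set _ _ (range s `*` range s')).
    by move=> _ [x _ <-]; split; exists x.
  exact: finite_setX.
move=> [x x'].
rewrite (_ : _ @^-1` _ = s @^-1` [set x] `&` s' @^-1` [set x']).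
  exact: measurableI.
by apply/seteqP; split=> [r [<- <-]|r [/= -> ->]].
Qed.

Variables (D : set R) (mD : measurable D) (fD : (mu D < +oo)%E).

Lemma finite_measure_fibre (T : Type) (s : R -> T) (A : set T) :
  fin_fun s -> mu (D `&` s @^-1` A) \is a fin_num.
Proof.
move=> hs; have mA := fin_fun_preimage A hs.
rewrite ge0_fin_numE//; apply: le_lt_trans fD.
by apply: le_measure; rewrite ?inE//; exact: measurableI.
Qed.

Lemma simple_fun_integrable (V : normedModType R) (s : R -> V) :
  simple_fun s -> simple_integrable D s.
Proof.
move=> hs; split=> // x _.
by rewrite -ge0_fin_numE//; exact: (finite_measure_fibre [set x] hs).
Qed.

Lemma fibre_measureE (T T' : choiceType) (s : R -> T) (h : T -> T') (y : T') :
  fin_fun s ->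
  fine (mu (D `&` (h \o s) @^-1` [set y])) =
  \sum_(p <- fset_set (range s))
    if h p == y then fine (mu (D `&` s @^-1` [set p])) else 0.
Proof.
move=> hs; have [fs ms] := hs.
have -> : D `&` (h \o s) @^-1` [set y] =
    \bigcup_(p in range s) (if h p == y then D `&` s @^-1` [set p] else set0).
  apply/seteqP; split=> [r [Dr /= hsr]|r [p _]].
    by exists (s r); [exists r|rewrite hsr eqxx].
  by case: eqP => // <- [Dr /= ->].
rewrite measure_fin_bigcup//; last 2 first.
- apply/trivIsetP => i j _ _ ij.
  case: (h i =P y) => _; last by rewrite set0I.
  case: (h j =P y) => _; last by rewrite setI0.
  apply/seteqP; split=> // r [[_ /= ri] [_ /= rj]].
  by move: ij; rewrite -ri -rj eqxx.
- by move=> i _; case: ifP => _ //; exact: measurableI mD (ms _).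
rewrite fsbig_finite//= -sum_fine//; last first.
  move=> p _; case: ifP => _; last by rewrite measure0.
  exact: finite_measure_fibre.
by apply: eq_bigr => p _; case: ifP => _ //; rewrite measure0.
Qed.

(** The integral may be computed along any finer partition than the one into
    level sets.  Applied to the pair of two simple functions, this gives
    additivity; applied to discretised data, it gives the comparison of
    integrals in two spaces. *)
Lemma simple_integral_comp (T : choiceType) (V : normedModType R)
    (s : R -> T) (h : T -> V) : fin_fun s ->
  simple_integral D (h \o s) =
  \sum_(p <- fset_set (range s)) fine (mu (D `&` s @^-1` [set p])) *: h p.
Proof.
move=> hs; have fhs := (fin_fun_comp h hs).1.
rewrite /simple_integral fsbig_finite//=.
under eq_bigr => y _ do rewrite fibre_measureE// scaler_suml.
rewrite exchange_big/= big_seq [RHS]big_seq; apply: eq_bigr => p.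
rewrite in_fset_set ?inE; last exact: hs.1.
move=> [r _ srp].
rewrite (bigD1_seq (h p))/=; last 2 first.
- by rewrite in_fset_set// inE; exists r => //=; rewrite srp.
- exact: finmap.fset_uniq.
rewrite eqxx big1 ?addr0// => y yhp.
by rewrite eq_sym (negbTE yhp) scale0r.
Qed.

Lemma simple_integralB (V : normedModType R) (s s' : R -> V) :
  simple_fun s -> simple_fun s' ->
  simple_integral D (s \- s') = simple_integral D s - simple_integral D s'.
Proof.
move=> hs hs'; pose p x := (s x, s' x).
have hp : fin_fun p by apply: fin_fun_pair.
rewrite (_ : s \- s' = (fun q => q.1 - q.2) \o p)//.
rewrite -[in RHS](_ : fst \o p = s)// -[in RHS](_ : snd \o p = s')//.
rewrite !simple_integral_comp// -sumrB.
by apply: eq_bigr => q _; rewrite scalerBr.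
Qed.

Lemma norm_simple_integral (V : normedModType R) (s : R -> V) :
  simple_fun s ->
  (`|simple_integral D s|%:E <= \int[mu]_(t in D) `|s t|%:E)%E.
Proof.
move=> hs; have [fs ms] := hs.
have -> : (\int[mu]_(t in D) `|s t|%:E =
    \int[mu]_(t in D) (\sum_(x \in range s)
       (`|x|%:E * (\1_(s @^-1` [set x]) t)%:E)))%E.
  apply: eq_integral => t _.
  rewrite (fsbigD1 (s t))//=; last by exists t.
  rewrite indicE mem_set// mule1 fsbig1 ?adde0// => x [_ /= xst].
  by rewrite indicE memNset ?mule0// => /= tx; apply: xst; rewrite tx.
rewrite ge0_integral_fsum//; last first.
  move=> x; apply: measurable_funeM.
  by apply/measurable_EFinP; exact: measurable_indic (ms _).
have -> : (\sum_(x \in range s) \int[mu]_(t in D)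
      (`|x|%:E * (\1_(s @^-1` [set x]) t)%:E) =
    \sum_(x <- fset_set (range s))
      (fine (mu (D `&` s @^-1` [set x])) * `|x|)%:E)%E.
  rewrite fsbig_finite//=; apply: eq_bigr => x _.
  rewrite ge0_integralZl_EFin//; last first.
    by apply/measurable_EFinP; exact: measurable_indic (ms _).
  rewrite integral_indic; [|exact: mD|exact: ms].
  rewrite setIC EFinM fineK 1?muleC//.
  exact: (finite_measure_fibre [set x] hs).
rewrite sumEFin lee_fin /simple_integral fsbig_finite//=.
apply: le_trans (ler_norm_sum _ _ _) _; apply: ler_sum => x _.
by rewrite normrZ ger0_norm// fine_ge0.
Qed.

End SimpleFunctions.

(** * Integrals of norms of strongly measurable functions *)
Section LowerIntegral.
Variable R : realType.
Local Notation mu := (@lebesgue_measure R).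

(** The integral of a nonnegative function is a supremum over simple functions
    below it, so monotonicity holds without measurability. *)
Lemma le_lower_integral (D : set R) (f g : R -> \bar R) :
  (forall t, D t -> 0 <= f t)%E -> (forall t, D t -> f t <= g t)%E ->
  (\int[mu]_(t in D) f t <= \int[mu]_(t in D) g t)%E.
Proof.
move=> f0 fg; rewrite !ge0_integralE//; last first.
  by move=> t Dt; exact: le_trans (f0 _ Dt) (fg _ Dt).
apply: le_ereal_sup => _ [h hf <-]; exists h => //= t.
apply: le_trans (hf t) _.
by rewrite !patchE; case: ifPn => // /set_mem; exact: fg.
Qed.

(** The norms of the approximating simple functions are Borel and converge to
    [|f|] off a Borel null set [N].  Their upper limit, set to [+oo] on [N],
    dominates [|f|]; set to [0] on [N], it is dominated by [|f|].  Both have the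
    same integral, which is squeezed to that of [|f|]. *)
Lemma norm_envelope (V : normedModType R) (D : set R) (f : R -> V) :
  measurable D -> strongly_measurable D f ->
  exists G : R -> \bar R,
    [/\ measurable_fun D G, forall t, (0 <= G t)%E,
        forall t, D t -> (`|f t|%:E <= G t)%E,
        {ae mu, forall t, D t -> G t = `|f t|%:E} &
        (\int[mu]_(t in D) G t = \int[mu]_(t in D) `|f t|%:E)%E].
Proof.
move=> mD [s [hs [N [mN N0 sN]]]].
pose H t := `|limn_esup (fun k => `|s k t|%:E)|%E.
have mH : measurable_fun D H.
  apply: measurableT_comp => //; apply: measurable_fun_limn_esup => k.
  apply/measurable_EFinP => _ Y _.
  by apply: measurableI => //; exact: (fin_fun_preimage _ (fin_fun_comp _ (hs k))).
have Hf t : D t -> ~ N t -> H t = `|f t|%:E.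
  move=> Dt Nt; have /cvg_norm sf : s ^~ t @ \oo --> f t.
    by apply: contrapT => sft; apply: Nt; apply: sN => /= /(_ Dt).
  have sf' : (fun k => `|s k t|%:E) @ \oo --> `|f t|%:E.
    by apply: cvg_EFin sf; near=> k.
  rewrite /H limn_esup_lim (cvg_lim _ (cvg_esups sf'))//.
  by rewrite gee0_abs.
have mtN : measurable_fun D (fun t => t \in N).
  apply: (measurable_fun_bool true); apply: measurableI => //.
  rewrite (_ : _ @^-1` _ = N)//.
  by apply/seteqP; split => t /=; [move/set_mem|move/mem_set].
pose G t := if t \in N then +oo%E else H t.
pose L t := if t \in N then 0%E else H t.
have mG : measurable_fun D G.
  by apply: measurable_fun_if => //; exact: measurable_funS mH.
have mL : measurable_fun D L.
  by apply: measurable_fun_if => //; exact: measurable_funS mH.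
have aeG : {ae mu, forall t, D t -> G t = `|f t|%:E}.
  exists N; split => // t; apply: contra_notP => Nt Dt.
  by rewrite /G memNset// Hf.
have fG t : D t -> (`|f t|%:E <= G t)%E.
  move=> Dt; rewrite /G; case: (boolP (t \in N)) => [_|]; first exact: leey.
  by rewrite notin_setE => /(Hf _ Dt) ->.
have H0 t : (0 <= H t)%E by exact: abse_ge0.
have G0 t : (0 <= G t)%E by rewrite /G; case: ifP => _; rewrite ?leey.
have L0 t : (0 <= L t)%E by rewrite /L; case: ifP.
exists G; split => //.
apply/eqP; rewrite eq_le; apply/andP; split; last exact: le_lower_integral.
rewrite (@ge0_ae_eq_integral _ _ _ mu D G L)//.
- apply: le_lower_integral => t Dt; rewrite /L; case: ifPn => //.
  by rewrite notin_setE => /(Hf _ Dt) ->.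
- exists N; split => // t; apply: contra_notP => Nt Dt.
  by rewrite /G /L memNset.
Unshelve. all: by end_near. Qed.

Lemma aeS (P Q : R -> Prop) : (forall t, P t -> Q t) ->
  {ae mu, forall t, P t} -> {ae mu, forall t, Q t}.
Proof. exact: (@filterS _ _ (ae_filter_ringOfSetsType mu)). Qed.

Lemma aeS2 (P Q H : R -> Prop) : (forall t, P t -> Q t -> H t) ->
  {ae mu, forall t, P t} -> {ae mu, forall t, Q t} -> {ae mu, forall t, H t}.
Proof. exact: (@filterS2 _ _ (ae_filter_ringOfSetsType mu)). Qed.

Lemma simple_strongly_measurable (V : normedModType R) (D : set R) (s : R -> V) :
  simple_fun s -> strongly_measurable D s.
Proof.
by move=> hs; exists (fun=> s); split => //; apply: aeW => t _; exact: cvg_cst.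
Qed.

Lemma strongly_measurable_comp2 (V W Z : normedModType R) (D : set R)
    (h : V -> W -> Z) (f : R -> V) (g : R -> W) :
  (forall (v : nat -> V) (w : nat -> W) x y, v @ \oo --> x -> w @ \oo --> y ->
     (fun k => h (v k) (w k)) @ \oo --> h x y) ->
  strongly_measurable D f -> strongly_measurable D g ->
  strongly_measurable D (fun t => h (f t) (g t)).
Proof.
move=> hc [s [hs sf]] [s' [hs' sf']].
exists (fun k t => h (s k t) (s' k t)); split.
  move=> k; apply: (fin_fun_comp (fun q => h q.1 q.2)
                     (s := fun t => (s k t, s' k t))).
  exact: fin_fun_pair (hs k) (hs' k).
by apply: aeS2 sf sf' => t sf sg Dt; apply: hc; [exact: sf|exact: sg].
Qed.

Lemma strongly_measurableB (V : normedModType R) (D : set R) (f g : R -> V) :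
  strongly_measurable D f -> strongly_measurable D g ->
  strongly_measurable D (f \- g).
Proof.
by apply: (strongly_measurable_comp2 (h := fun x y : V => x - y)) => *; exact: cvgB.
Qed.

Lemma lower_integral_norm_triangle (V W Z : normedModType R) (D : set R)
    (h : R -> Z) (f : R -> V) (g : R -> W) :
  measurable D -> strongly_measurable D f -> strongly_measurable D g ->
  (forall t, D t -> `|h t| <= `|f t| + `|g t|) ->
  (\int[mu]_(t in D) `|h t|%:E <=
   \int[mu]_(t in D) `|f t|%:E + \int[mu]_(t in D) `|g t|%:E)%E.
Proof.
move=> mD /(norm_envelope mD)[F [mF F0 fF _ <-]].
move=> /(norm_envelope mD)[G [mG G0 gG _ <-]] hfg.
rewrite -ge0_integralD//; apply: le_lower_integral => t Dt; first by rewrite lee_fin.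
apply: (@le_trans _ _ (`|f t| + `|g t|)%:E); first by rewrite lee_fin hfg.
by rewrite EFinD leeD ?fF ?gG.
Qed.

(** Dominated convergence to zero, by applying the scalar theorem to the Borel
    envelopes of the norms. *)
Lemma cvg_lower_integral0 (V : normedModType R) (D : set R)
    (h : nat -> R -> V) (g : R -> R) :
  measurable D -> (forall k, strongly_measurable D (h k)) ->
  {ae mu, forall t, D t -> h ^~ t @ \oo --> 0} ->
  {ae mu, forall t k, D t -> `|h k t| <= g t} ->
  mu.-integrable D (EFin \o g) ->
  (fun k => \int[mu]_(t in D) `|h k t|%:E)%E @ \oo --> 0%E.
Proof.
move=> mD hm h0 hg ig.
have /choice[G hG] := fun k => norm_envelope mD (hm k).
have -> : (fun k => \int[mu]_(t in D) `|h k t|%:E)%E =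
          (fun k => \int[mu]_(t in D) G k t)%E.
  by apply/funext => k; case: (hG k).
have Gh : {ae mu, forall t k, D t -> G k t = `|h k t|%:E}.
  have : forall k, {ae mu, forall t, D t -> G k t = `|h k t|%:E}.
    by move=> k; case: (hG k).
  by move=> /ae_foralln; apply: aeS => t + k; exact.
have cG : {ae mu, forall t, D t -> G ^~ t @ \oo --> 0%E}.
  apply: aeS2 Gh h0 => t Gh h0 Dt.
  rewrite (_ : G ^~ t = fun k => `|h k t|%:E); last first.
    by apply/funext => k; exact: Gh.
  apply: cvg_EFin; first by near=> k.
  have := cvg_norm (h0 Dt); rewrite normr0; exact.
have Gg : {ae mu, forall t k, D t -> (`|G k t| <= (g t)%:E)%E}.
  apply: aeS2 Gh hg => t Gh hg k Dt.
  by rewrite (Gh k Dt) gee0_abs// lee_fin hg.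
have mG k : measurable_fun D (G k) by case: (hG k).
rewrite -[X in _ --> X](@integral0 _ _ _ mu D).
by have [] := @dominated_convergence _ _ _ mu D mD G (cst 0%E) _ mG (measurable_cst _) cG ig Gg.
Unshelve. all: by end_near. Qed.

End LowerIntegral.

(** * Bochner integrals on a set of finite measure *)
Section BochnerTheory.
Variable R : realType.
Local Notation mu := (@lebesgue_measure R).

Lemma norm_le_cvg0 (V : normedModType R) (v : nat -> V) (u : nat -> \bar R) :
  (forall k, `|v k|%:E <= u k)%E -> u @ \oo --> 0%E -> v @ \oo --> 0.
Proof.
move=> vu u0; apply/norm_cvg0P.
have : (fun k => `|v k|%:E) @ \oo --> 0%E.
  apply: (@squeeze_cvge _ _ _ _ (cst 0%E) _ u) => //; last exact: cvg_cst.
  by apply: nearW => k; rewrite vu lee_fin normr_ge0.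
by move/fine_cvgP => -[_].
Qed.

Lemma cvg_of_dist_bound (V : completeNormedModType R) (v : nat -> V)
    (e : nat -> R) :
  (forall k l, `|v k - v l| <= e k + e l) -> e @ \oo --> 0 -> cvg (v @ \oo).
Proof.
move=> ve e0; apply: cauchy_cvg; apply/cauchy_ballP => eps eps0.
have /cvgr0_norm_lt/(_ _ (divr_gt0 eps0 (ltr0n R 2)))[N _ hN] := e0.
exists (v @` [set k | (N <= k)%N], v @` [set k | (N <= k)%N]).
  by split; exists N => // k /= Nk; exists k.
move=> [_ _] [/= [k Nk <-] [l Nl <-]].
rewrite -ball_normE /=; apply: le_lt_trans (ve k l) _.
rewrite [eps]splitr; apply: ler_ltD; last first.
  by apply: le_lt_trans (ler_norm _) _; exact: hN.
by apply: ltW; apply: le_lt_trans (ler_norm _) _; exact: hN.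
Qed.

Variables (D : set R) (mD : measurable D) (fD : (mu D < +oo)%E).

Section fixed_space.
Variable V : normedModType R.
Implicit Types (f : R -> V) (v : V).

Lemma is_bochner_strongly_measurable f v :
  is_bochner D f v -> strongly_measurable D f.
Proof. by move=> [s [hs sf _ _]]; exists s; split => // k; case: (hs k). Qed.

(** Two approximating sequences are close in mean, since both are close to [f];
    hence so are their integrals. *)
Lemma is_bochner_unique f v w : is_bochner D f v -> is_bochner D f w -> v = w.
Proof.
move=> bv bw; have mf := is_bochner_strongly_measurable bv.
move: bv bw => [s [hs sf sf0 sv]] [s' [hs' sf' sf0' sw]].
have ss k : simple_fun (s k) by case: (hs k).
have ss' k : simple_fun (s' k) by case: (hs' k).
have H : (fun k => simple_integral D (s k) - simple_integral D (s' k)) @ \oo --> 0.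
  apply: (norm_le_cvg0 (u := fun k => (\int[mu]_(t in D) `|f t - s k t|%:E +
    \int[mu]_(t in D) `|f t - s' k t|%:E)%E)).
    move=> k; rewrite -simple_integralB//.
    apply: le_trans (norm_simple_integral mD fD _) _.
      exact: (fin_fun_comp (fun q => q.1 - q.2) (fin_fun_pair (ss k) (ss' k))).
    apply: (lower_integral_norm_triangle (f := f \- s k) (g := f \- s' k)) => //.
    - by apply: strongly_measurableB => //; exact: simple_strongly_measurable.
    - by apply: strongly_measurableB => //; exact: simple_strongly_measurable.
    - move=> t _ /=; rewrite (distrC (f t) (s k t)).
      by rewrite (le_trans _ (ler_normD _ _))// addrA subrK.
  by rewrite -[X in _ --> X](adde0 0%E); apply: cvgeD.
have H' : (fun k => simple_integral D (s k) -
    simple_integral D (s' k)) @ \oo --> v - w by exact: cvgB.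
have /eqP : 0 = v - w by exact: (cvg_unique (@norm_hausdorff R V) H H').
by rewrite eq_sym subr_eq0 => /eqP.
Qed.

Lemma eq_is_bochner f g v : (forall t, D t -> f t = g t) ->
  is_bochner D f v -> is_bochner D g v.
Proof.
move=> fg [s [hs sf sf0 sv]]; exists s; split => //.
  by apply: aeS sf => t sf Dt; rewrite -fg//; exact: sf.
rewrite [X in X @ \oo --> _](_ : _ = (fun k => \int[mu]_(t in D) `|f t - s k t|%:E)%E)//.
apply/funext => k; apply: eq_integral => t /set_mem Dt.
by rewrite fg.
Qed.

Lemma bochnerE f v : is_bochner D f v -> bochner D f = v.
Proof.
move=> bv; apply: is_bochner_unique (bv).
exact: (@xgetI _ 0 [set v | is_bochner D f v] v bv).
Qed.

Lemma is_bochnerB f g v w : is_bochner D f v -> is_bochner D g w ->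
  is_bochner D (f \- g) (v - w).
Proof.
move=> bv bw.
have mf := is_bochner_strongly_measurable bv.
have mg := is_bochner_strongly_measurable bw.
move: bv bw => [s [hs sf sf0 sv]] [s' [hs' sf' sf0' sw]].
have ss k : simple_fun (s k) by case: (hs k).
have ss' k : simple_fun (s' k) by case: (hs' k).
exists (fun k => s k \- s' k); split.
- move=> k; apply: simple_fun_integrable => //.
  exact: (fin_fun_comp (fun q => q.1 - q.2) (fin_fun_pair (ss k) (ss' k))).
- by apply: aeS2 sf sf' => t sf sf' Dt; apply: cvgB; [exact: sf|exact: sf'].
- apply: (@squeeze_cvge _ _ _ _ (cst 0%E) _ (fun k =>
    (\int[mu]_(t in D) `|f t - s k t|%:E +
    \int[mu]_(t in D) `|g t - s' k t|%:E)%E)); last 2 first.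
  + exact: cvg_cst.
  + by rewrite -[X in _ --> X](adde0 0%E); apply: cvgeD.
  apply: nearW => k; rewrite integral_ge0//=.
  apply: (lower_integral_norm_triangle (f := f \- s k) (g := g \- s' k)) => //.
  + by apply: strongly_measurableB => //; exact: simple_strongly_measurable.
  + by apply: strongly_measurableB => //; exact: simple_strongly_measurable.
  + move=> t _ /=; apply: le_trans (ler_normB _ _).
    by rewrite !opprB [s' k t - s k t]addrC addrACA [- g t + _]addrC.
- under eq_fun => k do rewrite simple_integralB//.
  exact: cvgB.
Qed.

(** The bound holds for the approximating simple functions up to an error that
    tends to zero. *)
Lemma norm_is_bochner f v : is_bochner D f v ->
  (`|v|%:E <= \int[mu]_(t in D) `|f t|%:E)%E.
Proof.
move=> bv; have mf := is_bochner_strongly_measurable bv.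
move: bv => [s [hs sf sf0 sv]].
have ss k : simple_fun (s k) by case: (hs k).
have sv' : (fun k => `|simple_integral D (s k)|%:E) @ \oo --> `|v|%:E.
  apply: cvg_EFin; first by near=> k.
  by have := cvg_norm sv; exact.
have bnd : (fun k => \int[mu]_(t in D) `|f t|%:E +
    \int[mu]_(t in D) `|f t - s k t|%:E)%E @ \oo --> (\int[mu]_(t in D) `|f t|%:E)%E.
  rewrite -[X in _ --> X]adde0; apply: cvgeD => //; last exact: cvg_cst.
  have I0 : (0 <= \int[mu]_(t in D) `|f t|%:E)%E by exact: integral_ge0.
  by rewrite ge0_adde_def// inE.
have le k : (`|simple_integral D (s k)|%:E <= \int[mu]_(t in D) `|f t|%:E +
    \int[mu]_(t in D) `|f t - s k t|%:E)%E.
  apply: le_trans (norm_simple_integral mD fD (ss k)) _.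
  apply: (lower_integral_norm_triangle (g := f \- s k)) => //.
  - by apply: strongly_measurableB => //; exact: simple_strongly_measurable.
  - by move=> t _ /=; rewrite (le_trans _ (ler_normB _ _))// opprB addrC subrK.
rewrite -(cvg_lim _ sv')// -(cvg_lim _ bnd)//; apply: lee_lim => //.
- by apply/cvg_ex; eexists; exact: sv'.
- by apply/cvg_ex; eexists; exact: bnd.
- exact: nearW.
Unshelve. all: by end_near. Qed.

Lemma norm_is_bochner_le f v (g : R -> R) : is_bochner D f v ->
  (forall t, D t -> `|f t| <= g t) ->
  (`|v|%:E <= \int[mu]_(t in D) (g t)%:E)%E.
Proof.
move=> /norm_is_bochner bv fg; apply: le_trans bv _.
by apply: le_lower_integral => t Dt; rewrite lee_fin ?fg.
Qed.
End fixed_space.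

(** Domination turns almost everywhere convergence into convergence in mean,
    which makes the integrals of the simple functions a Cauchy sequence. *)
Lemma bochner_dominated (V : completeNormedModType R) (f : R -> V)
    (s : nat -> R -> V) (g : R -> R) :
  (forall k, simple_fun (s k)) ->
  {ae mu, forall t, D t -> s ^~ t @ \oo --> f t} ->
  (forall k t, D t -> `|s k t| <= g t) ->
  mu.-integrable D (EFin \o g) ->
  is_bochner D f (bochner D f) /\
  (fun k => simple_integral D (s k)) @ \oo --> bochner D f.
Proof.
move=> hs sf sg ig.
have mf : strongly_measurable D f by exists s.
pose e k := (\int[mu]_(t in D) `|f t - s k t|%:E)%E.
have mfs k : strongly_measurable D (f \- s k).
  by apply: strongly_measurableB => //; exact: simple_strongly_measurable.
have e0 : e @ \oo --> 0%E.
  apply: (cvg_lower_integral0 (h := fun k => f \- s k) (g := fun t => 2 * g t)) => //.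
  - apply: aeS sf => t sf Dt; rewrite -(subrr (f t)).
    by apply: cvgB; [exact: cvg_cst|exact: sf].
  - apply: aeS sf => t sf k Dt.
    apply: le_trans (ler_normB _ _) _; rewrite mulr_natl mulr2n lerD ?sg//.
    by apply: cvgr_to_le (cvg_norm (sf Dt)) _; apply: nearW => l; exact: sg.
  - rewrite (_ : _ \o _ = fun t => (2%:E * (EFin \o g) t)%E)//.
    exact: integrableZl.
have eB k l : (`|simple_integral D (s k) - simple_integral D (s l)|%:E <= e k + e l)%E.
  rewrite -simple_integralB//; apply: le_trans (norm_simple_integral mD fD _) _.
    exact: (fin_fun_comp (fun q => q.1 - q.2) (fin_fun_pair (hs k) (hs l))).
  apply: (lower_integral_norm_triangle (f := f \- s k) (g := f \- s l)) => //.
  move=> t _ /=; rewrite (distrC (f t) (s k t)).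
  by rewrite (le_trans _ (ler_normD _ _))// addrA subrK.
have /fine_cvgP[[N _ efin] fe0] := e0.
have /cvg_ex[v hv] : cvg ((fun k => simple_integral D (s (k + N)%N)) @ \oo).
  apply: (@cvg_of_dist_bound _ _ (fun k => fine (e (k + N)%N))) => [k l|].
    by rewrite -lee_fin EFinD !fineK ?eB//; apply: efin; exact: leq_addl.
  by rewrite (cvg_shiftn N (fine \o e)).
rewrite (cvg_shiftn N (fun k => simple_integral D (s k))) in hv.
have bv : is_bochner D f v.
  by exists s; split => // k; exact: simple_fun_integrable.
by rewrite (bochnerE bv).
Qed.
End BochnerTheory.

(** * Integrals of powers with endpoint singularities *)
Section Scalar.
Variable R : realType.
Local Notation mu := (@lebesgue_measure R).

(** The fundamental theorem on compact subintervals and monotone convergence: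
    [f] may blow up at both ends. *)
Lemma integral_oo_primitive_le (a b C : R) (f F : R -> R) : a < b ->
  (forall x, a < x < b -> 0 <= f x) ->
  (forall x, a < x < b -> {for x, continuous f}) ->
  (forall x, a < x < b -> is_derive x 1 F (f x)) ->
  (forall x y, a < x < b -> a < y < b -> F y - F x <= C) ->
  (\int[mu]_(x in `]a, b[) (f x)%:E <= C%:E)%E.
Proof.
move=> ab f0 cf dF FC.
(* The denominator exceeds 2, so that the subinterval cut by [d k] is nonempty. *)
pose d (k : nat) : R := (b - a) / (k%:R + 3).
have ba0 : 0 < b - a by rewrite subr_gt0.
have d0 k : 0 < d k by rewrite divr_gt0// ltr_wpDl.
have dd k : d k + d k < b - a.
  rewrite -mulr2n -mulr_natr /d mulrAC -mulrA gtr_pMr// ltr_pdivrMr ?ltr_wpDl//.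
  by rewrite mul1r ltr_wpDl// ltr_nat.
pose I k := `[a + d k, b - d k]%classic.
have Isub k x : I k x -> a < x < b.
  rewrite /I /= in_itv/= => /andP[ax xb]; have := d0 k.
  by move: ax xb; set dk := d k => ax xb dk0; apply/andP; split; lra.
have Iab : `]a, b[%classic = \bigcup_k I k.
  apply/seteqP; split=> x; last first.
    by move=> [k _ /Isub]; rewrite /= in_itv.
  rewrite /= in_itv/= => /andP[ax xb].
  have m0 : 0 < Num.min (x - a) (b - x) by rewrite lt_min !subr_gt0 ax.
  have [k hk] : exists k, d k <= Num.min (x - a) (b - x).
    exists (Num.bound ((b - a) / Num.min (x - a) (b - x))).
    have := archi_boundP (divr_ge0 (ltW ba0) (ltW m0)).
    set k := Num.bound _ => hk.
    rewrite /d ler_pdivrMr ?ltr_wpDl// mulrC -ler_pdivrMr//.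
    by apply: (le_trans (ltW hk)); rewrite lerDl.
  exists k => //; rewrite /I /= in_itv/=.
  by move: hk; rewrite le_min => /andP[h1 h2]; apply/andP; split; lra.
have mf : measurable_fun `]a, b[ f.
  apply: open_continuous_measurable_fun => //.
  by move=> x; rewrite inE /= in_itv/=; exact: cf.
have H : (fun k => \int[mu]_(x in I k) (f x)%:E)%E @ \oo -->
    (\int[mu]_(x in `]a, b[) (f x)%:E)%E.
  rewrite Iab; apply: ge0_nondecreasing_set_cvg_integral.
  - move=> m k mk; apply/subsetPset => x; rewrite /I /= !in_itv/=.
    have dkm : d k <= d m.
      rewrite /d ler_pM2l// lef_pV2 ?posrE ?ltr_wpDl//.
      by rewrite lerD2r ler_nat.
    by move=> /andP[h1 h2]; apply/andP; split; lra.
  - by move=> k; exact: measurable_itv.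
  - move=> k; apply/measurable_EFinP; apply: measurable_funS mf => //.
    by move=> x /Isub; rewrite /= in_itv.
  - by move=> k x /Isub ?; rewrite lee_fin f0.
rewrite -(cvg_lim _ H)//; apply: lime_le; first by apply/cvg_ex; eexists; exact: H.
apply: nearW => k.
have adk : a + d k < b - d k by have := dd k; lra.
have inI x : a + d k <= x <= b - d k -> a < x < b.
  by move=> hx; apply: (Isub k); rewrite /I /= in_itv.
rewrite (@continuous_FTC2 _ f F)//.
- rewrite -EFinB lee_fin; apply: FC; apply: inI; first by rewrite lexx ltW.
  by rewrite lexx ltW.
- apply: continuous_in_subspaceT => x; rewrite inE /= in_itv/= => /inI.
  exact: cf.
- have cF x : a < x < b -> {for x, continuous F}.
    by move=> hx; apply/differentiable_continuous/derivable1_diffP; case: (dF x hx).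
  split.
  + move=> x; rewrite in_itv/= => /andP[h1 h2].
    by have /dF[] : a < x < b by apply: inI; rewrite !ltW.
  + by apply: cvg_at_right_filter; apply: cF; apply: inI; rewrite lexx ltW.
  + by apply: cvg_at_left_filter; apply: cF; apply: inI; rewrite lexx ltW.
- move=> x; rewrite in_itv/= => /andP[h1 h2].
  have hx : a < x < b by apply: inI; rewrite !ltW.
  by rewrite derive1E; apply: @derive_val; exact: dF.
Qed.

Lemma is_derive_powR_primitive (p x : R) : p < 1 -> 0 < x ->
  is_derive x 1 (fun y => y `^ (1 - p) / (1 - p)) (x `^ (- p)).
Proof.
move=> p1 x0; have p0 : 1 - p != 0 by rewrite subr_eq0 gt_eqF.
have H := is_derive1_powR (1 - p) x0.
rewrite (_ : (fun y => _) = (1 - p)^-1 \*: (@powR R)^~ (1 - p)); last first.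
  by apply/funext => y /=; rewrite mulrC.
apply: is_derive_eq; rewrite /GRing.scale/= mulrA mulVf// mul1r.
by congr (_ `^ _); ring.
Qed.

Lemma integral_powR_le (p t : R) : 0 <= p < 1 -> 0 < t ->
  (\int[mu]_(x in `]0%R, t[) (x `^ (- p))%R%:E <= (t `^ (1 - p) / (1 - p))%R%:E)%E.
Proof.
move=> /andP[p0 p1] t0; have p1' : 0 < 1 - p by rewrite subr_gt0.
apply: (integral_oo_primitive_le (F := fun y => y `^ (1 - p) / (1 - p))) => //.
- by move=> x _; exact: powR_ge0.
- move=> x /andP[x0 _]; apply/differentiable_continuous/derivable1_diffP.
  by apply: derivable_powR; rewrite in_itv/= x0.
- by move=> x /andP[x0 _]; exact: is_derive_powR_primitive.
- move=> x y /andP[x0 xt] /andP[y0 yt]; rewrite -mulrBl ler_pM2r ?invr_gt0//.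
  rewrite lerBlDr ler_wpDr ?powR_ge0// ge0_ler_powR ?nnegrE ?ltW//.
Qed.

Lemma integral_powR_rev_le (p a b : R) : 0 <= p < 1 -> a < b ->
  (\int[mu]_(x in `]a, b[) ((b - x) `^ (- p))%R%:E <=
   ((b - a) `^ (1 - p) / (1 - p))%R%:E)%E.
Proof.
move=> /andP[p0 p1] ab; have p1' : 0 < 1 - p by rewrite subr_gt0.
pose F y := (b - y) `^ (1 - p) / (1 - p).
have dB (x : R) : is_derive x 1 (fun y : R => b - y) (-1 : R).
  by apply: is_derive_eq; rewrite add0r mul1r.
apply: (integral_oo_primitive_le (F := \- F)) => //.
- by move=> x _; exact: powR_ge0.
- move=> x /andP[_ xb]; apply: (@continuous_comp _ _ _ (fun y => b - y) ((@powR R)^~ (- p))).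
    by apply/differentiable_continuous/derivable1_diffP; case: (dB x).
  apply/differentiable_continuous/derivable1_diffP.
  by apply: derivable_powR; rewrite in_itv/= subr_gt0 xb.
- move=> x /andP[_ xb]; have bx0 : 0 < b - x by rewrite subr_gt0.
  have H := is_derive_powR_primitive p1 bx0.
  have H' := @is_derive1_comp _ (fun y => y `^ (1 - p) / (1 - p)) (fun y => b - y) x _ _ H (dB x).
  by have := @is_deriveN _ _ _ _ _ _ _ H'; rewrite mulrN1 opprK.
- move=> x y /andP[ax xb] /andP[ay yb] /=; rewrite opprK addrC /F -mulrBl.
  rewrite ler_pM2r ?invr_gt0// lerBlDr ler_wpDr ?powR_ge0//.
  rewrite ge0_ler_powR ?nnegrE ?subr_ge0 ?ltW//; lra.
Qed.

Lemma measurable_powR_rev (D : set R) (p b : R) :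
  measurable_fun D (fun x : R => (b - x) `^ (- p)).
Proof.
apply: (measurableT_comp (measurable_powR (- p))).
by apply: measurable_funB => //; exact: measurable_cst.
Qed.

(** A bound for the Beta integral [B(1 - p, 1 - q)]. *)
Definition beta_const (p q : R) : R :=
  2 `^ p / (1 - q) + 2 `^ q / (1 - p).

Lemma beta_const_ge0 (p q : R) : p < 1 -> q < 1 -> 0 <= beta_const p q.
Proof.
by move=> p1 q1; rewrite addr_ge0// divr_ge0 ?powR_ge0// subr_ge0 ltW.
Qed.

Lemma powR_half (t p : R) : 0 < t -> (t / 2) `^ (- p) = 2 `^ p * t `^ (- p).
Proof.
by move=> t0; rewrite powRM ?ltW// mulrC -powR_inv1// -powRrM mulN1r opprK.
Qed.

Lemma ler_powRN (p x y : R) : 0 <= p -> 0 < x -> x <= y -> y `^ (- p) <= x `^ (- p).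
Proof.
move=> p0 x0 xy; rewrite !powRN lef_pV2 ?posrE ?powR_gt0//; last exact: lt_le_trans xy.
by rewrite ge0_ler_powR// nnegrE ltW//; exact: lt_le_trans xy.
Qed.

(** On each half of [(0, t)] one of the two factors is at most its value at
    [t / 2], and the other one is integrable. *)
Lemma integral_beta_le (p q t : R) : 0 <= p < 1 -> 0 <= q < 1 -> 0 < t ->
  (\int[mu]_(x in `]0%R, t[) ((t - x) `^ (- p) * x `^ (- q))%R%:E <=
   (beta_const p q * t `^ (1 - p - q))%R%:E)%E.
Proof.
move=> hp hq t0; have /andP[p0 p1] := hp; have /andP[q0 q1] := hq.
have mN r : measurable_fun `]0, t[ (fun x : R => x `^ (- r)).
  by apply: measurable_funS (measurable_powR (- r)).
have mR : measurable_fun `]0, t[ (fun x : R => (t - x) `^ (- p)).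
  exact: measurable_powR_rev.
apply: (@le_trans _ _ (\int[mu]_(x in `]0%R, t[)
   (((t / 2) `^ (- p))%R%:E * (x `^ (- q))%R%:E +
    ((t / 2) `^ (- q))%R%:E * ((t - x) `^ (- p))%R%:E))%E).
  apply: ge0_le_integral => //.
  - by move=> x _; rewrite lee_fin mulr_ge0 ?powR_ge0.
  - by apply/measurable_EFinP; apply: measurable_funM mR (mN q).
  - by apply: emeasurable_funD; apply: measurable_funeM; apply/measurable_EFinP; [exact: mN|exact: mR].
  move=> x; rewrite /= in_itv/= => /andP[x0 xt].
  rewrite -!EFinM -EFinD lee_fin.
  have [h|h] := leP x (t / 2).
    apply: ler_wpDr; first by rewrite mulr_ge0 ?powR_ge0.
    rewrite ler_wpM2r ?powR_ge0// ler_powRN//; first by rewrite divr_gt0.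
    lra.
  apply: ler_wpDl; first by rewrite mulr_ge0 ?powR_ge0.
  rewrite mulrC ler_wpM2r ?powR_ge0// ler_powRN//; first by rewrite divr_gt0.
  lra.
rewrite ge0_integralD//; last 4 first.
- by move=> x _; rewrite -EFinM lee_fin mulr_ge0 ?powR_ge0.
- by apply: measurable_funeM; apply/measurable_EFinP; exact: mN.
- by move=> x _; rewrite -EFinM lee_fin mulr_ge0 ?powR_ge0.
- by apply: measurable_funeM; apply/measurable_EFinP; exact: mR.
rewrite !ge0_integralZl_EFin ?powR_ge0//; last 4 first.
- by move=> x _; rewrite lee_fin powR_ge0.
- by apply/measurable_EFinP; exact: mR.
- by move=> x _; rewrite lee_fin powR_ge0.
- by apply/measurable_EFinP; exact: mN.
have tt r s : t `^ (- r) * t `^ (1 - s) = t `^ (1 - r - s).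
  rewrite -powRD; last by rewrite (gt_eqF t0) implybT.
  by congr (_ `^ _); ring.
apply: (@le_trans _ _ (((t / 2) `^ (- p))%R%:E * (t `^ (1 - q) / (1 - q))%R%:E +
  ((t / 2) `^ (- q))%R%:E * (t `^ (1 - p) / (1 - p))%R%:E)%E).
  apply: leeD; apply: lee_wpmul2l; rewrite ?lee_fin ?powR_ge0//.
    exact: integral_powR_le.
  by have := integral_powR_rev_le hp t0; rewrite subr0.
rewrite -!EFinM -EFinD lee_fin !powR_half// /beta_const.
rewrite !mulrA -[X in X / (1 - q)]mulrA tt -[X in X / (1 - p)]mulrA tt.
rewrite (_ : 1 - q - p = 1 - p - q); last by ring.
by rewrite mulrDl [X in X + _]mulrAC [X in _ + X]mulrAC.
Qed.

Lemma expRN_le_powR (x q : R) : 0 < x -> 0 <= q <= 1 -> expR (- x) <= x `^ (- q).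
Proof.
move=> x0 /andP[q0 q1]; rewrite expRN powRN lef_pV2 ?posrE ?expR_gt0 ?powR_gt0//.
have [x1|x1] := leP 1 x.
  apply: (@le_trans _ _ x); first by exact: ler1_powR.
  by apply: le_trans (expR_ge1Dx x); rewrite lerDr.
apply: (@le_trans _ _ 1); last by rewrite -expR0 ler_expR ltW.
by rewrite -[leRHS](powRr0 x) ger_powR// x0 ltW.
Qed.
End Scalar.

(** * Exponentially weighted singular kernels *)
Section Weights.
Variable R : realType.
Local Notation mu := (@lebesgue_measure R).

Lemma measurable_beta (D : set R) (p q t : R) :
  measurable_fun D (fun x : R => (t - x) `^ (- p) * x `^ (- q)).
Proof.
apply: measurable_funM; first exact: measurable_powR_rev.
exact: measurable_funS (measurable_powR (- q)).
Qed.

Lemma integral_scaled_beta_le (c p q t : R) : 0 <= c ->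
  0 <= p < 1 -> 0 <= q < 1 -> 0 < t ->
  (\int[mu]_(x in `]0%R, t[) (c * ((t - x) `^ (- p) * x `^ (- q)))%R%:E <=
   (c * (beta_const p q * t `^ (1 - p - q)))%R%:E)%E.
Proof.
move=> c0 hp hq t0.
under eq_integral => x _ do rewrite EFinM.
rewrite ge0_integralZl_EFin//; last 2 first.
- by move=> x _; rewrite lee_fin mulr_ge0 ?powR_ge0.
- by apply/measurable_EFinP; exact: measurable_beta.
by rewrite EFinM lee_wpmul2l// integral_beta_le.
Qed.

Lemma integrable_beta (c p q t : R) : 0 <= c ->
  0 <= p < 1 -> 0 <= q < 1 -> 0 < t ->
  mu.-integrable `]0, t[ (EFin \o (fun x => c * ((t - x) `^ (- p) * x `^ (- q)))).
Proof.
move=> c0 hp hq t0; apply/integrableP; split.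
  apply/measurable_EFinP; apply: measurable_funM; first exact: measurable_cst.
  exact: measurable_beta.
apply: le_lt_trans (ltry (c * (beta_const p q * t `^ (1 - p - q)))).
apply: le_trans (integral_scaled_beta_le c0 hp hq t0).
apply: le_lower_integral => x _ /=; first by rewrite lee_fin.
by rewrite lee_fin ger0_norm// !mulr_ge0 ?powR_ge0.
Qed.

Definition weight (q l t : R) : R := t `^ (- q) * expR (l * t).

Lemma weight_gt0 (q l t : R) : 0 < t -> 0 < weight q l t.
Proof. by move=> t0; rewrite mulr_gt0 ?powR_gt0 ?expR_gt0. Qed.

(** The factor [exp(- l (t - x)) <= (l (t - x))^(-h)] trades a slightly stronger
    singularity for the small constant [l^(-h)]; with [h = (1 - p) / 2] the
    exponent [p + h] is still below one. *)
Lemma weighted_kernel_contraction (M T p q e : R) :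
  0 <= M -> 0 < T -> 0 <= p < 1 -> 0 <= q < 1 -> 0 < e ->
  exists2 l, 0 < l & forall a t, 0 <= a -> 0 < t -> t <= T ->
    (\int[mu]_(x in `]0%R, t[) (M * ((t - x) `^ (- p) * (a * weight q l x)))%R%:E <=
     (e * (a * weight q l t))%R%:E)%E.
Proof.
move=> M0 T0 hp hq e0; have /andP[p0 p1] := hp.
pose h := (1 - p) / 2; pose p' := p + h.
have h0 : 0 < h by rewrite divr_gt0// subr_gt0.
have h1 : 0 <= h <= 1 by rewrite /h; apply/andP; split; lra.
have hp' : 0 <= p' < 1 by rewrite /p' /h; apply/andP; split; lra.
pose A := M * (beta_const p' q * T `^ (1 - p')).
have A0 : 0 <= A.
  by rewrite !mulr_ge0 ?powR_ge0// beta_const_ge0//; [case/andP: hp'|case/andP: hq].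
pose B := A / e + 1.
have B0 : 0 < B by rewrite /B ltr_wpDl// divr_ge0// ltW.
(* Chosen so that [l^(-h) = 1 / B], and [A / B <= e]. *)
pose l := B `^ h^-1; have l0 : 0 < l by rewrite powR_gt0.
exists l => // a t a0 t0 tT.
have lh : l `^ (- h) = B^-1.
  by rewrite /l -powRrM mulrN mulVf ?gt_eqF// powR_inv1// ltW.
pose c := a * M * (B^-1 * expR (l * t)).
have c0 : 0 <= c by rewrite !mulr_ge0 ?expR_ge0// invr_ge0 ltW.
apply: (@le_trans _ _ (\int[mu]_(x in `]0%R, t[)
    (c * ((t - x) `^ (- p') * x `^ (- q)))%R%:E)%E).
  apply: le_lower_integral => x /=; rewrite in_itv/= => /andP[x0 xt].
    by rewrite lee_fin !mulr_ge0 ?powR_ge0 ?expR_ge0.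
  have tx0 : 0 < t - x by rewrite subr_gt0.
  rewrite lee_fin /c /weight.
  have -> : l * x = l * t - l * (t - x) by ring.
  rewrite expRD /p' opprD powRD; last by rewrite (gt_eqF tx0) implybT.
  have := expRN_le_powR (mulr_gt0 l0 tx0) h1.
  rewrite powRM; [|exact: ltW|exact: ltW]; rewrite lh => H.
  rewrite (_ : M * _ = a * M * ((t - x) `^ (- p) * x `^ (- q) * expR (l * t)) *
    expR (- (l * (t - x)))); last by ring.
  rewrite (_ : _ * (B^-1 * _) * _ = a * M * ((t - x) `^ (- p) * x `^ (- q) *
    expR (l * t)) * (B^-1 * (t - x) `^ (- h))); last by ring.
  by rewrite ler_wpM2l// !mulr_ge0 ?powR_ge0 ?expR_ge0.
apply: le_trans (integral_scaled_beta_le c0 hp' hq t0) _.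
rewrite lee_fin /weight.
rewrite (@powRD _ t (1 - p') (- q)); last by rewrite (gt_eqF t0) implybT.
have Tt : t `^ (1 - p') <= T `^ (1 - p').
  apply: ge0_ler_powR; rewrite ?nnegrE; [|exact: ltW..|exact: tT].
  by case/andP: hp' => _ ?; rewrite subr_ge0 ltW.
rewrite (_ : c * _ = M * (beta_const p' q * t `^ (1 - p')) * B^-1 *
  (a * (t `^ (- q) * expR (l * t)))); last by rewrite /c; ring.
rewrite ler_wpM2r ?mulr_ge0 ?powR_ge0 ?expR_ge0//.
rewrite ler_pdivrMr//; apply: (@le_trans _ _ A).
  rewrite /A ler_wpM2l// ler_wpM2l// beta_const_ge0//; first by case/andP: hp'.
  by case/andP: hq.
by rewrite /B mulrDr mulr1 mulrCA divff ?gt_eqF// mulr1 lerDl ltW.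
Qed.
End Weights.

(** * Discretisation of time and truncation *)
Section Approximation.
Variable R : realType.
Local Notation mu := (@lebesgue_measure R).

(** Index of the cell of length [1 / (k + 1)] containing [x], counted from one;
    zero is reserved for the points outside of [(0, t)].  The end points of the
    cell are [grid_lo] and [grid_hi]. *)
Definition grid (t : R) (k : nat) (x : R) : nat :=
  if 0 < x < t then (Num.truncn (x * k.+1%:R)).+1 else 0.

Lemma grid_fin_fun (t : R) (k : nat) : fin_fun (grid t k).
Proof.
have k0 : 0 < k.+1%:R :> R by rewrite ltr0n.
split.
  apply: (@sub_finite_set _ _ `I_((Num.truncn (t * k.+1%:R)).+2)).
    2: exact: finite_II.
  move=> _ [x _ <-] /=; rewrite /grid; case: ifP => // /andP[x0 xt].
  rewrite !ltnS; apply: le_truncn.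
  by rewrite ler_pM2r// ltW.
move=> [|m].
  rewrite (_ : _ @^-1` _ = ~` `]0, t[).
    by apply: measurableC; exact: measurable_itv.
  apply/seteqP; split=> x /=; rewrite in_itv/= /grid; first by case: ifP.
  by case: ifP => //= _ /(_ isT).
rewrite (_ : _ @^-1` _ = `]0, t[ `&` `[m%:R / k.+1%:R, m.+1%:R / k.+1%:R[).
  by apply: measurableI; exact: measurable_itv.
apply/seteqP; split=> x /=; rewrite !in_itv/= /grid.
  case: ifP => // xt [<-]; split => //.
  rewrite ler_pdivrMr// ltr_pdivlMr//; apply: truncn_itv.
  by case/andP: xt => x0 _; rewrite mulr_ge0// ltW.
move=> [-> ]; rewrite ler_pdivrMr// ltr_pdivlMr// => H; congr S.
exact: truncn_def.
Qed.

Definition grid_lo (k n : nat) : R := n.-1%:R / k.+1%:R.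
Definition grid_hi (k n : nat) : R := n%:R / k.+1%:R.

Lemma grid_bounds (t x : R) (k : nat) : 0 < x < t ->
  [/\ 0 <= grid_lo k (grid t k x), grid_lo k (grid t k x) <= x,
      x < grid_hi k (grid t k x) &
      grid_hi k (grid t k x) = grid_lo k (grid t k x) + k.+1%:R^-1].
Proof.
move=> xt; rewrite /grid_lo /grid_hi /grid xt/=; case/andP: xt => x0 xt.
have k0 : 0 < k.+1%:R :> R by rewrite ltr0n.
have /truncn_itv/andP[h1 h2] : 0 <= x * k.+1%:R by rewrite mulr_ge0// ltW.
split.
- by rewrite divr_ge0.
- by rewrite ler_pdivrMr.
- by rewrite ltr_pdivlMr.
- by rewrite -{3}(mul1r (_^-1)) -mulrDl -natr1.
Qed.

Lemma cvg_between (x : R) (u : nat -> R) :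
  (forall k, `|u k - x| <= k.+1%:R^-1) -> u @ \oo --> x.
Proof.
move=> ux; apply/subr_cvg0.
apply: (norm_le_cvg0 (u := fun k => (k.+1%:R^-1)%:E)).
  by move=> k; rewrite lee_fin.
apply: cvg_EFin; first exact: nearW.
exact: cvg_harmonic.
Qed.

Lemma cvg_grid_lo (t x : R) : 0 < x < t ->
  (fun k => grid_lo k (grid t k x)) @ \oo --> x.
Proof.
move=> xt; apply: cvg_between => k; have [h1 h2 h3 h4] := grid_bounds k xt.
have /andP[H0 H] : 0 <= x - grid_lo k (grid t k x) <= k.+1%:R^-1.
  by move: h3; rewrite h4 subr_ge0 lerBlDl => h3; rewrite h2 ltW.
by rewrite distrC ger0_norm.
Qed.

Lemma cvg_grid_hi (t x : R) : 0 < x < t ->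
  (fun k => grid_hi k (grid t k x)) @ \oo --> x.
Proof.
move=> xt; apply: cvg_between => k; have [h1 h2 h3 h4] := grid_bounds k xt.
have /andP[H0 H] : 0 <= grid_hi k (grid t k x) - x <= k.+1%:R^-1.
  by rewrite subr_ge0 ltW// h4 lerBlDr [leRHS]addrC lerD2r.
by rewrite ger0_norm.
Qed.

Lemma cvg_powR (u : nat -> R) (x r : R) : 0 < x -> u @ \oo --> x ->
  (fun k => u k `^ r) @ \oo --> x `^ r.
Proof.
move=> x0 ux; have cx : {for x, continuous ((@powR R)^~ r)}.
  apply/differentiable_continuous/derivable1_diffP.
  by apply: derivable_powR; rewrite in_itv/= x0.
exact: (cvg_comp _ _ ux cx).
Qed.

(** Radial retraction of [x] onto the ball of radius [r]. *)
Definition truncation (V : normedModType R) (r : R) (x : V) : V :=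
  (r / Num.max r `|x|) *: x.

Lemma norm_truncation_le (V : normedModType R) (r : R) (x : V) : 0 < r ->
  `|truncation r x| <= r.
Proof.
move=> r0; have m0 : 0 < Num.max r `|x| by rewrite lt_max r0.
have c0 : 0 <= r / Num.max r `|x| by rewrite divr_ge0// ltW.
rewrite normrZ ger0_norm// mulrAC ler_pdivrMr//.
by rewrite ler_wpM2l ?(ltW r0)// le_max lexx orbT.
Qed.

Lemma cvg_truncation (V : normedModType R) (r : nat -> R) (x : nat -> V)
    (r0 : R) (x0 : V) : 0 < r0 -> `|x0| <= r0 ->
  r @ \oo --> r0 -> x @ \oo --> x0 ->
  (fun k => truncation (r k) (x k)) @ \oo --> x0.
Proof.
move=> r0_gt0 x0r0 cr cx.
have m0 : Num.max r0 `|x0| = r0 by rewrite max_l.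
have cm : (fun k => Num.max (r k) `|x k|) @ \oo --> r0.
  rewrite -[X in _ --> X]m0.
  under eq_fun => k do rewrite maxr_absE.
  rewrite maxr_absE; apply: cvgMl; apply: cvgD.
    by apply: cvgD => //; exact: cvg_norm.
  by apply: cvg_norm; apply: cvgB => //; exact: cvg_norm.
have r0_neq0 : r0 != 0 by rewrite gt_eqF.
rewrite -[X in _ --> X]scale1r -(divff r0_neq0).
by apply: cvgZ => //; apply: cvgM => //; apply: cvgV.
Qed.

(** Time is rounded down, so that a kernel [(t - x)^(-p)] at the rounded time is
    at most its value at [x].  The radius of truncation is computed from the time
    rounded up, so that it is at most [C x^(-q)] and takes finitely many values.
    These data do not depend on the kernel that will be applied to them. *)
Lemma approximation_by_simple_data (U : normedModType R) (y : R -> U)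
    (t q C : R) : 0 <= q -> 0 < C ->
  strongly_measurable `]0, t[ y ->
  (forall x, 0 < x < t -> `|y x| <= C * x `^ (- q)) ->
  exists p : nat -> R -> R * U,
    [/\ forall k, fin_fun (p k),
        forall k x, 0 < x < t -> 0 <= (p k x).1 <= x,
        forall k x, 0 < x < t -> `|(p k x).2| <= C * x `^ (- q),
        forall x, 0 < x < t -> (fun k => (p k x).1) @ \oo --> x &
        {ae mu, forall x, `]0, t[%classic x -> (fun k => (p k x).2) @ \oo --> y x}].
Proof.
move=> q0 C0 [s [hs sy]] yC.
exists (fun k x => (grid_lo k (grid t k x),
  truncation (C * grid_hi k (grid t k x) `^ (- q)) (s k x))); split.
- move=> k; apply: (fin_fun_comp (fun d : nat * U =>
    (grid_lo k d.1, truncation (C * grid_hi k d.1 `^ (- q)) d.2))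
    (s := fun x => (grid t k x, s k x))).
  exact: fin_fun_pair (grid_fin_fun t k) (hs k).
- by move=> k x xt /=; have [-> -> _ _] := grid_bounds k xt.
- move=> k x xt /=; have [_ _ h _] := grid_bounds k xt; case/andP: xt => x0 _.
  apply: le_trans (norm_truncation_le _ _) _.
    by rewrite mulr_gt0// powR_gt0// (lt_trans x0).
  by rewrite ler_wpM2l// ?ler_powRN// ltW.
- by move=> x xt; exact: cvg_grid_lo.
- apply: aeS sy => x sy xt; have xt' : 0 < x < t by move: xt; rewrite /= in_itv.
  have x0 : 0 < x by case/andP: xt'.
  apply: (@cvg_truncation _ _ _ (C * x `^ (- q))).
  + by rewrite mulr_gt0// powR_gt0.
  + exact: yC.
  + by apply: cvgMr; apply: cvg_powR => //; exact: cvg_grid_hi xt'.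
  + exact: sy.
Qed.

(** Continuity from the right suffices for strong measurability, and it is
    easier to obtain for a convolution than continuity: at times [r > t] the
    singularity of [(r - x)^(-p)] lies outside of [(0, t)], where
    [(t - x)^(-p)] dominates it. *)
Definition right_continuous (V : normedModType R) (u : R -> V) : Prop :=
  forall t, 0 < t -> forall r : nat -> R, (forall k, t < r k) ->
    r @ \oo --> t -> (u \o r) @ \oo --> u t.

(** Step functions sampling [u] at the upper grid points converge to [u], as
    these points converge to the given time from the right. *)
Lemma right_continuous_strongly_measurable (V : normedModType R) (u : R -> V) :
  right_continuous u -> strongly_measurable `]0, +oo[ u.
Proof.
move=> cu; exists (fun k x => u (grid_hi k (grid k%:R k x))); split.
  by move=> k; apply: fin_fun_comp (fun n => u (grid_hi k n)) _ _; exact: grid_fin_fun.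
apply: aeW => x; rewrite /= in_itv/= andbT => x0.
(* The [k]-th step function samples [u] only over [(0, k)], so [x] is reached from
   index [N] on. *)
pose N := Num.bound x.
have xN k : 0 < x < (k + N)%:R.
  rewrite x0 (lt_le_trans (archi_boundP (ltW x0)))//.
  by rewrite ler_nat leq_addl.
rewrite -(cvg_shiftn N).
apply: (cu x x0 (fun k => grid_hi (k + N)%N (grid (k + N)%:R (k + N)%N x))).
  by move=> k; have [] := grid_bounds (k + N) (xN k).
rewrite (cvg_shiftn N (fun k => grid_hi k (grid k%:R k x))).
rewrite -(cvg_shiftn N).
apply: cvg_between => k; have [h1 h2 h3 h4] := grid_bounds (k + N) (xN k).
have /andP[H0 H] : 0 <= grid_hi (k + N) (grid (k + N)%:R (k + N) x) - x
    <= k.+1%:R^-1.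
  rewrite subr_ge0 ltW// h4 lerBlDr [leRHS]addrC lerD//.
  by rewrite lef_pV2 ?posrE ?ltr0n// ler_nat ltnS leq_addr.
by rewrite ger0_norm.
Qed.
End Approximation.

(** * Convolutions with singular operator kernels *)
Section Kernels.
Variable R : realType.
Local Notation mu := (@lebesgue_measure R).

Definition kernel_bound (U V : normedModType R) (K : R -> U -> V)
    (p T M : R) : Prop :=
  forall (s : R) (x : U), 0 < s -> s <= T -> `|K s x| <= M * s `^ (- p) * `|x|.

(** An abstract smoothing operator: the constant of the bound on [(0, T]] may
    grow with [T]. *)
Definition singular_kernel (U V : normedModType R) (K : R -> U -> V) (p : R) :
    Prop :=
  [/\ forall (s : R) (x y : U), 0 < s -> K s (x - y) = K s x - K s y,
      forall T, 0 < T -> exists2 M, 0 <= M & kernel_bound K p T M &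
      forall (x : U) (s : R) (r : nat -> R), 0 < s -> r @ \oo --> s ->
        (fun k => K (r k) x) @ \oo --> K s x].

Definition convolution (U V : normedModType R) (K : R -> U -> V) (y : R -> U)
    (t : R) : V := bochner `]0, t[ (fun x => K (t - x) (y x)).

Lemma lebesgue_measure_oo_lty (t : R) : (mu `]0%R, t[ < +oo)%E.
Proof.
by rewrite lebesgue_measure_itv/=; case: ifP => _; rewrite -?EFinB ltry.
Qed.

(** With [K] applied to the discretised data one obtains simple functions
    dominated by a multiple of [(t - x)^(-p) x^(-q)].  They converge because
    [K (t - x_k)] is bounded uniformly in [k] and strongly continuous. *)
Lemma convolution_cvg_simple_data (U : normedModType R) (V : completeNormedModType R)
    (K : R -> U -> V) (y : R -> U) (p q C t : R) (d : nat -> R -> R * U) :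
  singular_kernel K p -> 0 <= p < 1 -> 0 <= q < 1 -> 0 <= C -> 0 < t ->
  (forall k, fin_fun (d k)) ->
  (forall k x, 0 < x < t -> 0 <= (d k x).1 <= x) ->
  (forall k x, 0 < x < t -> `|(d k x).2| <= C * x `^ (- q)) ->
  (forall x, 0 < x < t -> (fun k => (d k x).1) @ \oo --> x) ->
  {ae mu, forall x, `]0, t[%classic x -> (fun k => (d k x).2) @ \oo --> y x} ->
  is_bochner `]0, t[ (fun x => K (t - x) (y x)) (convolution K y t) /\
  (fun k => simple_integral `]0, t[ ((fun e => K (t - e.1) e.2) \o d k)) @ \oo
    --> convolution K y t.
Proof.
move=> [KB Kb Kc] hp hq C0 t0 hd d1 d2 cd1 cd2.
have [M M0 KM] := Kb t t0; have /andP[p0 p1] := hp.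
have bK k x e : 0 < x < t ->
    `|K (t - (d k x).1) e| <= M * (t - x) `^ (- p) * `|e|.
  move=> xt; have /andP[h1 h2] := d1 k x xt; case/andP: xt => x0 xt.
  have s0 : 0 < t - (d k x).1 by rewrite subr_gt0 (le_lt_trans h2).
  apply: le_trans (KM _ _ s0 _) _; first by rewrite gerBl.
  rewrite ler_wpM2r// ler_wpM2l// ler_powRN// ?subr_gt0//.
  by rewrite lerD2l lerN2.
apply: (bochner_dominated (measurable_itv _) (lebesgue_measure_oo_lty t)
   (g := fun x => (M * C) * ((t - x) `^ (- p) * x `^ (- q)))).
- by move=> k; apply: fin_fun_comp (hd k).
- apply: aeS cd2 => x cd2 xt; have xt' : 0 < x < t by move: xt; rewrite /= in_itv.
  have tx0 : 0 < t - x by rewrite subr_gt0; case/andP: xt'.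
  apply/subr_cvg0.
  have c1 : (fun k => K (t - (d k x).1) (y x)) @ \oo --> K (t - x) (y x).
    by apply: Kc => //; apply: cvgB; [exact: cvg_cst|exact: cd1].
  have c2 : (fun k => K (t - (d k x).1) ((d k x).2 - y x)) @ \oo --> 0.
    apply: (norm_le_cvg0 (u := fun k =>
      (M * (t - x) `^ (- p) * `|(d k x).2 - y x|)%:E)).
      by move=> k; rewrite lee_fin bK.
    apply: cvg_EFin; first exact: nearW.
    rewrite -(mulr0 (M * (t - x) `^ (- p))); apply: cvgMr.
    by apply/norm_cvg0P/subr_cvg0; exact: cd2.
  rewrite (_ : (fun _ => _) = fun k => K (t - (d k x).1) ((d k x).2 - y x) +
    (K (t - (d k x).1) (y x) - K (t - x) (y x))); last first.
    apply/funext => k /=; rewrite KB ?addrA ?subrK//.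
    rewrite subr_gt0; have /andP[_ h2] := d1 k x xt'.
    by apply: le_lt_trans h2 _; case/andP: xt'.
  by rewrite -(addr0 0); apply: cvgD => //; apply/subr_cvg0.
- move=> k x; rewrite /= in_itv/= => xt; apply: le_trans (bK k x _ xt) _.
  rewrite (_ : M * C * _ = M * (t - x) `^ (- p) * (C * x `^ (- q))); last by ring.
  by rewrite ler_wpM2l ?mulr_ge0 ?powR_ge0// d2.
- by apply: integrable_beta => //; rewrite mulr_ge0.
Qed.

Lemma convolution_is_bochner (U : normedModType R) (V : completeNormedModType R)
    (K : R -> U -> V) (y : R -> U) (p q C t : R) :
  singular_kernel K p -> 0 <= p < 1 -> 0 <= q < 1 -> 0 < t ->
  strongly_measurable `]0, t[ y ->
  (forall x, 0 < x < t -> `|y x| <= C * x `^ (- q)) ->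
  is_bochner `]0, t[ (fun x => K (t - x) (y x)) (convolution K y t).
Proof.
move=> hK hp hq t0 my yC; have /andP[q0 q1] := hq.
pose C' := `|C| + 1; have C'0 : 0 < C' by rewrite /C' ltr_wpDl.
have yC' x : 0 < x < t -> `|y x| <= C' * x `^ (- q).
  move=> xt; apply: le_trans (yC x xt) _; rewrite ler_wpM2r ?powR_ge0//.
  by rewrite /C' (le_trans (ler_norm C))// lerDl.
have [d [h1 h2 h3 h4 h5]] := approximation_by_simple_data q0 C'0 my yC'.
by have [] := convolution_cvg_simple_data hK hp hq (ltW C'0) t0 h1 h2 h3 h4 h5.
Qed.

Lemma norm_convolution_le (U : normedModType R) (V : normedModType R)
    (K : R -> U -> V) (y : R -> U) (w : R -> R) (p t M : R) :
  0 <= M -> kernel_bound K p t M ->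
  is_bochner `]0, t[ (fun x => K (t - x) (y x)) (convolution K y t) ->
  (forall x, 0 < x < t -> `|y x| <= w x) ->
  (`|convolution K y t|%:E <=
   \int[mu]_(x in `]0%R, t[) (M * ((t - x) `^ (- p) * w x))%R%:E)%E.
Proof.
move=> M0 KM by_ yw.
apply: (norm_is_bochner_le (measurable_itv _) (lebesgue_measure_oo_lty t) by_).
move=> x; rewrite /= in_itv/= => xt; have /andP[x0 x1] := xt.
apply: le_trans (KM _ _ _ _) _; first by rewrite subr_gt0.
  by rewrite gerBl ltW.
by rewrite mulrA ler_wpM2l ?mulr_ge0 ?powR_ge0// yw.
Qed.

Lemma norm_convolution_powR_le (U : normedModType R) (V : normedModType R)
    (K : R -> U -> V) (y : R -> U) (p q C M t : R) :
  0 <= p < 1 -> 0 <= q < 1 -> 0 < t -> 0 <= M -> 0 <= C -> kernel_bound K p t M ->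
  is_bochner `]0, t[ (fun x => K (t - x) (y x)) (convolution K y t) ->
  (forall x, 0 < x < t -> `|y x| <= C * x `^ (- q)) ->
  `|convolution K y t| <= M * C * (beta_const p q * t `^ (1 - p - q)).
Proof.
move=> hp hq t0 M0 C0 KM bK yC; rewrite -lee_fin.
apply: le_trans (norm_convolution_le M0 KM bK yC) _.
apply: le_trans (integral_scaled_beta_le (mulr_ge0 M0 C0) hp hq t0).
apply: le_lower_integral => x _; first by rewrite lee_fin !mulr_ge0 ?powR_ge0.
by rewrite lee_fin le_eqVlt; apply/orP; left; apply/eqP; ring.
Qed.

(** Linearity in [y] is only meaningful between functions whose convolutions
    exist; existence for the difference follows. *)
Lemma convolutionB (U : normedModType R) (V : normedModType R)
    (K : R -> U -> V) (y y' : R -> U) (p t : R) :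
  singular_kernel K p ->
  is_bochner `]0, t[ (fun x => K (t - x) (y x)) (convolution K y t) ->
  is_bochner `]0, t[ (fun x => K (t - x) (y' x)) (convolution K y' t) ->
  is_bochner `]0, t[ (fun x => K (t - x) (y x - y' x))
    (convolution K (y \- y') t) /\
  convolution K (y \- y') t = convolution K y t - convolution K y' t.
Proof.
move=> [KB _ _] b1 b2.
have mD : measurable (`]0, t[%classic : set R) by exact: measurable_itv.
have b3 : is_bochner `]0, t[ (fun x => K (t - x) (y x - y' x))
    (convolution K y t - convolution K y' t).
  apply: eq_is_bochner (is_bochnerB mD (lebesgue_measure_oo_lty t) b1 b2).
  by move=> x; rewrite /= in_itv/= => /andP[_ xt]; rewrite KB// subr_gt0.
have -> : convolution K (y \- y') t = convolution K y t - convolution K y' t.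
  exact: (bochnerE mD (lebesgue_measure_oo_lty t) b3).
by [].
Qed.

End Kernels.

(** * Extension by zero *)
Definition cutoff (R : realType) (V : normedModType R) (A : set R) (f : R -> V)
  (x : R) : V := if x \in A then f x else 0.

Section Restriction.
Variable R : realType.
Local Notation mu := (@lebesgue_measure R).

Lemma fin_fun_mem (A : set R) : measurable A -> fin_fun (fun x => x \in A).
Proof.
move=> mA; split; first exact: finite_finset.
move=> [].
  rewrite (_ : _ @^-1` _ = A)//.
  by apply/seteqP; split => x /=; [move/set_mem|move/mem_set].
rewrite (_ : _ @^-1` _ = ~` A); first exact: measurableC.
apply/seteqP; split => x /=; first by move/negbT; rewrite notin_setE.
by move=> Ax; rewrite memNset.
Qed.

Lemma simple_fun_restrict (V : normedModType R) (A : set R) (s : R -> V) :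
  measurable A -> simple_fun s -> simple_fun (cutoff A s).
Proof.
move=> mA hs.
apply: (fin_fun_comp (fun e : V * bool => if e.2 then e.1 else 0)
  (s := fun x => (s x, x \in A))).
exact: fin_fun_pair hs (fin_fun_mem mA).
Qed.

Lemma strongly_measurable_restrict (V : normedModType R) (A D : set R)
    (f : R -> V) : measurable A ->
  strongly_measurable (A `&` D) f -> strongly_measurable D (cutoff A f).
Proof.
move=> mA [s [hs sf]]; exists (fun k => cutoff A (s k)); split.
  by move=> k; exact: simple_fun_restrict.
apply: aeS sf => t sf Dt; rewrite /cutoff; case: (boolP (t \in A)) => [/set_mem At|_].
  exact: sf.
exact: cvg_cst.
Qed.

Lemma is_bochner_restrict (V : normedModType R) (A D : set R) (f : R -> V) v :
  measurable A -> measurable D -> A `<=` D -> (mu D < +oo)%E ->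
  is_bochner A f v -> is_bochner D (cutoff A f) v.
Proof.
move=> mA mD AD fD [s [hs sf sf0 sv]].
have fA : (mu A < +oo)%E by apply: le_lt_trans fD; apply: le_measure; rewrite ?inE.
have ss k : simple_fun (s k) by case: (hs k).
have intE k : (\int[mu]_(t in D) `|(cutoff A f) t - cutoff A (s k) t|%:E =
               \int[mu]_(t in A) `|f t - s k t|%:E)%E.
  rewrite integral_mkcond [RHS]integral_mkcond; apply: eq_integral => t _.
  rewrite !patchE /cutoff; case: (boolP (t \in A)) => [/set_mem At|_].
    by rewrite mem_set//; exact: AD.
  by rewrite subrr normr0; case: ifP.
have sumE k : simple_integral D (cutoff A (s k)) = simple_integral A (s k).
  pose p x := (s k x, x \in A).
  have hp : fin_fun p by exact: fin_fun_pair (ss k) (fin_fun_mem mA).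
  rewrite (_ : cutoff A (s k) = (fun e : V * bool => if e.2 then e.1 else 0) \o p)//.
  rewrite -[in RHS](_ : fst \o p = s k)//.
  rewrite (simple_integral_comp mD fD _ hp) (simple_integral_comp mA fA _ hp).
  apply: eq_bigr => -[x [|]] _ /=.
    congr (fine (mu _) *: _); apply/seteqP; split => t [h /= e]; split => //.
      by apply/set_mem; case: e.
    exact: AD.
  rewrite scaler0 (_ : A `&` _ = set0) ?measure0 ?scale0r//.
  by apply/seteqP; split => t // [At [_ /=]]; rewrite mem_set.
exists (fun k => cutoff A (s k)); split.
- by move=> k; apply: simple_fun_integrable => //; exact: simple_fun_restrict.
- apply: aeS sf => t sf Dt; rewrite /cutoff; case: (boolP (t \in A)) => [/set_mem At|_].
    exact: sf.
  exact: cvg_cst.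
- by under eq_fun => k do rewrite intE.
- by under eq_fun => k do rewrite sumE.
Qed.

End Restriction.

(** * Right continuity of convolutions *)
Section RightContinuity.
Variable R : realType.
Local Notation mu := (@lebesgue_measure R).

Lemma cvg_tail_le (r : nat -> R) (t : R) : r @ \oo --> t ->
  exists N, forall k, r (k + N)%N <= t + 1.
Proof.
move=> rt; have /cvgrPdist_le /(_ 1 ltr01)[N _ hN] := rt.
exists N => k; have := hN (k + N)%N (leq_addl _ _).
by rewrite ler_distlC => /andP[_].
Qed.

(** All convolutions are written as integrals over the same interval [(0, T)].
    On [(0, t)] the integrands at times [r k > t] are dominated by the one at [t]
    and converge to it.  The remaining part is bounded by the integral of
    [(r k - x)^(-p)] over [(t, r k)], of order [(r k - t)^(1 - p)]. *)
Lemma right_continuous_convolution_bounded (U : normedModType R)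
    (V : completeNormedModType R) (K : R -> U -> V) (y : R -> U)
    (p q C T t : R) (r : nat -> R) :
  singular_kernel K p -> 0 <= p < 1 -> 0 <= q < 1 -> 0 <= C -> 0 < t ->
  strongly_measurable `]0, T[ y ->
  (forall x, 0 < x < T -> `|y x| <= C * x `^ (- q)) ->
  (forall k, t < r k <= T) -> r @ \oo --> t ->
  (fun k => convolution K y (r k)) @ \oo --> convolution K y t.
Proof.
move=> hK hp hq C0 t0 my yC rT rt; have /andP[p0 p1] := hp.
have p1' : 0 < 1 - p by rewrite subr_gt0.
have T0 : 0 < T by apply: lt_trans t0 _; have /andP[] := rT 0%N; exact: lt_le_trans.
have [KB Kb Kc] := hK; have [M M0 KM] := Kb T T0.
pose D : set R := `]0, T[%classic.
have mD : measurable D by exact: measurable_itv.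
have fD : (mu D < +oo)%E by exact: lebesgue_measure_oo_lty.
pose f s := cutoff `]0, s[ (fun x => K (s - x) (y x)).
have bf s : 0 < s -> s <= T -> is_bochner D (f s) (convolution K y s).
  move=> s0 sT; apply: is_bochner_restrict => //.
    by move=> x; rewrite /D /= !in_itv/= => /andP[-> h]; rewrite (lt_le_trans h).
  apply: (convolution_is_bochner hK hp hq (C := C)) => //.
    have [s_ [hs sy]] := my; exists s_; split => //; apply: aeS sy => x sy.
    rewrite /= in_itv/= => /andP[x0 xs]; apply: sy.
    by rewrite /= in_itv/= x0/= (lt_le_trans xs).
  by move=> x /andP[x0 xs]; apply: yC; rewrite x0/= (lt_le_trans xs).
have tr k : t < r k by case/andP: (rT k).
have rT' k : r k <= T by case/andP: (rT k).
have tT : t <= T by exact: le_trans (ltW (tr 0%N)) _.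
have Kb' s x : 0 < x -> x < s -> s <= T ->
    `|K (s - x) (y x)| <= M * (s - x) `^ (- p) * (C * x `^ (- q)).
  move=> x0 xs sT; apply: le_trans (KM _ _ _ _) _; first by rewrite subr_gt0.
    by apply: le_trans sT; rewrite gerBl ltW.
  rewrite ler_wpM2l// ?mulr_ge0 ?powR_ge0//; apply: yC.
  by rewrite x0/= (lt_le_trans xs).
pose A : set R := `]0, t[%classic.
have mA : measurable A by exact: measurable_itv.
pose h k := f (r k) \- f t.
have bh k : is_bochner D (h k) (convolution K y (r k) - convolution K y t).
  by apply: is_bochnerB => //; apply: bf => //; exact: lt_trans (tr k).
have mh k B : measurable B -> strongly_measurable D (cutoff B (h k)).
  move=> mB; apply: strongly_measurable_restrict => //.
  have [s [hs sf]] := is_bochner_strongly_measurable (bh k).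
  by exists s; split => //; apply: aeS sf => x sf [_]; exact: sf.
apply/subr_cvg0; apply: (norm_le_cvg0 (u := fun k =>
  (\int[mu]_(x in D) `|cutoff A (h k) x|%:E + \int[mu]_(x in D) `|cutoff (~` A) (h k) x|%:E)%E)).
  move=> k; apply: le_trans (norm_is_bochner mD fD (bh k)) _.
  apply: lower_integral_norm_triangle => //.
  - exact: mh.
  - by apply: mh; exact: measurableC.
  - move=> x _; rewrite /cutoff; case: (boolP (x \in A)) => xA.
      by rewrite in_setC xA normr0 addr0.
    by rewrite in_setC xA normr0 add0r.
rewrite -[X in _ --> X](adde0 0%E); apply: cvgeD => //.
- pose g x := (2 * (M * C)) * ((t - x) `^ (- p) * x `^ (- q)).
  apply: (cvg_lower_integral0 (g := g \_ A)) => //.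
  + by move=> k; exact: mh.
  + apply: aeW => x Dx; rewrite /cutoff ?patchE; case: (boolP (x \in A)) => [|_]; last first.
      exact: cvg_cst.
    move=> /set_mem; rewrite /A /= in_itv/= => /andP[x0 xt].
    rewrite /h /f /= /cutoff.
    under eq_fun => k.
      rewrite !mem_set/=; last 2 first.
      * by rewrite in_itv/= x0.
      * by rewrite in_itv/= x0 (lt_trans xt).
      over.
    apply/subr_cvg0; apply: Kc; first by rewrite subr_gt0.
    by apply: cvgB => //; exact: cvg_cst.
  + apply: aeW => x k Dx; rewrite /cutoff ?patchE; case: (boolP (x \in A)) => [|_]; last first.
      by rewrite normr0.
    move=> /set_mem; rewrite /A /= in_itv/= => /andP[x0 xt].
    have xr := lt_trans xt (tr k).
    rewrite /h /f /= /cutoff !mem_set/=; last 2 first.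
    * by rewrite in_itv/= x0.
    * by rewrite in_itv/= x0.
    apply: le_trans (ler_normB _ _) _.
    apply: le_trans (lerD (Kb' _ _ x0 xr (rT' k)) (Kb' _ _ x0 xt tT)) _.
    rewrite /g (_ : 2 * _ * _ = M * (t - x) `^ (- p) * (C * x `^ (- q)) +
      M * (t - x) `^ (- p) * (C * x `^ (- q))); last by ring.
    rewrite lerD2r ler_wpM2r ?mulr_ge0 ?powR_ge0// ler_wpM2l// ler_powRN// ?subr_gt0//.
    by rewrite lerD2r ltW.
  + rewrite -restrict_EFin; apply/integrable_restrict => //.
    rewrite (_ : D `&` A = A); last first.
      apply/setIidr => x; rewrite /D /A /= !in_itv/= => /andP[-> xt].
      exact: lt_le_trans tT.
    by apply: integrable_beta => //; rewrite !mulr_ge0.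
- pose c := M * (C * t `^ (- q)).
  have c0 : 0 <= c by rewrite !mulr_ge0 ?powR_ge0.
  pose g k x := c * (r k - x) `^ (- p).
  have bnd k : (\int[mu]_(x in D) `|cutoff (~` A) (h k) x|%:E <=
      (c * ((r k - t) `^ (1 - p) / (1 - p)))%R%:E)%E.
    apply: (@le_trans _ _ (\int[mu]_(x in D) ((EFin \o g k) \_ `[t, r k[) x)%E).
      apply: le_lower_integral => x; rewrite ?lee_fin//.
      rewrite /D /= in_itv/= => /andP[x0 xT].
      have gk0 z : 0 <= g k z by rewrite mulr_ge0 ?powR_ge0.
      rewrite /cutoff patchE in_setC; case: (boolP (x \in A)) => [_|] /=.
        by rewrite normr0; case: ifP => // _; rewrite lee_fin.
      rewrite notin_setE /A /= in_itv/= x0/= => /negP; rewrite -leNgt => tx.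
      rewrite /h /f /= /cutoff [x \in `]0, t[%classic]memNset ?subr0; last first.
        by rewrite /= in_itv/= x0/= => xt; move: tx; rewrite leNgt xt.
      have [xr|rx] := ltP x (r k).
        rewrite !mem_set/= ?in_itv/= ?x0 ?tx//.
        rewrite lee_fin; apply: le_trans (Kb' _ _ x0 xr (rT' k)) _.
        rewrite /g /c (_ : M * (C * t `^ (- q)) * _ =
          M * (r k - x) `^ (- p) * (C * t `^ (- q))); last by ring.
        by rewrite ler_wpM2l ?mulr_ge0 ?powR_ge0// ler_wpM2l// ler_powRN//; case/andP: hq.
      have xr : (x < r k) = false by rewrite ltNge rx.
      by rewrite !memNset ?normr0//= in_itv/= xr andbF.
    rewrite -integral_mkcondr.
    have -> : D `&` `[t, r k[ = `[t, r k[%classic.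
      apply/setIidr => x; rewrite /D /= !in_itv/= => /andP[tx xr].
      by rewrite (lt_le_trans t0 tx) (lt_le_trans xr).
    have mg (B : set R) : measurable_fun B (EFin \o (fun x => (r k - x) `^ (- p))).
      by apply/measurable_EFinP; exact: measurable_powR_rev.
    rewrite /g -integral_itv_obnd_cbnd; last first.
      by apply/measurable_EFinP; apply: measurable_funM => //;
        exact: measurable_powR_rev.
    under eq_integral => x _ do rewrite /= EFinM.
    rewrite ge0_integralZl_EFin//; last 2 first.
    - by move=> x _; rewrite lee_fin powR_ge0.
    - exact: mg.
    by rewrite [leRHS]EFinM lee_wpmul2l// integral_powR_rev_le.
  apply: (@squeeze_cvge _ _ _ _ (cst 0%E) _
    (fun k => (c * ((r k - t) `^ (1 - p) / (1 - p)))%R%:E)); last 2 first.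
  + exact: cvg_cst.
  + apply: cvg_EFin; first exact: nearW.
    rewrite -(mulr0 c) -(mul0r (1 - p)^-1); apply: cvgMr; apply: cvgMl.
    have /cvg_at_rightP : (fun x : R => x `^ (1 - p)) y @[y --> 0^'+] --> (0 : R).
      exact: powR_cvg0.
    apply; split; first by move=> k; rewrite subr_gt0.
    by apply/subr_cvg0.
  + by apply: nearW => k; rewrite bnd andbT; exact: integral_ge0.
Qed.

End RightContinuity.

(** * Weighted bounds *)
Section Volterra.
Variable R : realType.
Local Notation mu := (@lebesgue_measure R).

Definition locally_weighted (V : normedModType R) (q : R) (u : R -> V) : Prop :=
  forall T, 0 < T -> exists2 C, 0 <= C &
    forall x, 0 < x -> x <= T -> `|u x| <= C * x `^ (- q).

Lemma powR_le_weight (q l x : R) : 0 <= l -> 0 < x -> x `^ (- q) <= weight q l x.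
Proof.
move=> l0 x0; rewrite /weight ler_peMr ?powR_ge0// -expR0 ler_expR.
by rewrite mulr_ge0// ltW.
Qed.

Lemma weight_le_powR (q l x T : R) : 0 <= l -> 0 < x -> x <= T ->
  weight q l x <= expR (l * T) * x `^ (- q).
Proof.
move=> l0 x0 xT; rewrite /weight mulrC ler_wpM2r ?powR_ge0// ler_expR.
by rewrite ler_wpM2l.
Qed.

Lemma le_of_harmonic (a b c : R) :
  (forall k, a <= b + c * k.+1%:R^-1) -> a <= b.
Proof.
move=> H; have ch : (fun k => b + c * k.+1%:R^-1) @ \oo --> b.
  rewrite -[X in _ --> X]addr0 -(mulr0 c); apply: cvgD; first exact: cvg_cst.
  by apply: cvgMr; exact: cvg_harmonic.
by apply: cvgr_to_ge ch _; exact: nearW.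
Qed.

(** Iterating [A -> B + A / 2] from the a priori bound [C] tends to [2 B].  The
    iterates are majorised by [2 B + C / (k + 1)]. *)
Lemma weighted_gronwall (V : normedModType R) (z : R -> V) (q l T B C : R) :
  0 <= l -> 0 <= B -> 0 <= C ->
  (forall x, 0 < x -> x <= T -> `|z x| <= C * x `^ (- q)) ->
  (forall A, 0 <= A ->
    (forall x, 0 < x -> x <= T -> `|z x| <= A * weight q l x) ->
    (forall x, 0 < x -> x <= T -> `|z x| <= (B + A / 2) * weight q l x)) ->
  forall x, 0 < x -> x <= T -> `|z x| <= 2 * B * weight q l x.
Proof.
move=> l0 B0 C0 zC H.
have Hk k : forall x, 0 < x -> x <= T ->
    `|z x| <= (2 * B + C * k.+1%:R^-1) * weight q l x.
  elim: k => [|k IH] x x0 xT.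
    apply: le_trans (zC x x0 xT) _; rewrite invr1 mulr1.
    apply: (@le_trans _ _ (C * weight q l x)).
      by rewrite ler_wpM2l// powR_le_weight.
    by rewrite ler_wpM2r ?(ltW (weight_gt0 _ _ _))// lerDr mulr_ge0.
  have A0 : 0 <= 2 * B + C * k.+1%:R^-1.
    by rewrite addr_ge0 ?mulr_ge0// invr_ge0.
  apply: le_trans (H _ A0 IH x x0 xT) _.
  rewrite ler_wpM2r ?(ltW (weight_gt0 _ _ _))//.
  rewrite (_ : B + _ = 2 * B + C * (k.+1%:R * 2)^-1); last first.
    by rewrite invfM; field; rewrite nat1r pnatr_eq0.
  rewrite lerD2l ler_wpM2l// lef_pV2 ?posrE ?mulr_gt0 ?ltr0n//.
  by rewrite -natrM ler_nat muln2 -addnn addSn ltnS addnS ltnS leq_addr.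
move=> x x0 xT; apply: (@le_of_harmonic _ _ (C * weight q l x)) => k.
by rewrite [C * _ * _]mulrAC -mulrDl Hk.
Qed.

Lemma convolution_locally_weighted (U : normedModType R)
    (V : completeNormedModType R) (K : R -> U -> V) (p q : R) (y : R -> U) :
  singular_kernel K p -> 0 <= p < 1 -> 0 <= q < 1 ->
  strongly_measurable `]0, +oo[ y -> locally_weighted q y ->
  locally_weighted q (convolution K y) /\ right_continuous (convolution K y) /\
  forall t, 0 < t -> is_bochner `]0, t[ (fun x => K (t - x) (y x)) (convolution K y t).
Proof.
move=> hK hp hq my wy.
have myT T : strongly_measurable `]0, T[ y.
  have [s [hs sy]] := my; exists s; split => //; apply: aeS sy => x sy.
  by rewrite /= in_itv/= => /andP[x0 _]; apply: sy; rewrite /= in_itv/= x0.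
have bK t : 0 < t -> is_bochner `]0, t[ (fun x => K (t - x) (y x)) (convolution K y t).
  move=> t0; have [C C0 yC] := wy t t0.
  apply: (convolution_is_bochner hK hp hq t0 (myT t) (C := C)).
  by move=> x /andP[x0 xt]; apply: yC => //; exact: ltW.
split; last split => //.
- move=> T T0; have [C C0 yC] := wy T T0.
  have [KB Kb _] := hK; have [M M0 KM] := Kb T T0.
  have /andP[p0 p1] := hp; have /andP[q0 q1] := hq.
  have b0 := beta_const_ge0 p1 q1.
  exists (M * C * (beta_const p q * T `^ (1 - p))).
    by rewrite !mulr_ge0 ?powR_ge0.
  move=> t t0 tT.
  have KMt : kernel_bound K p t M.
    by move=> s x s0 st; apply: KM => //; exact: le_trans tT.
  have yCt x : 0 < x < t -> `|y x| <= C * x `^ (- q).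
    by move=> /andP[x0 xt]; apply: yC => //; exact: le_trans (ltW xt) tT.
  apply: le_trans (norm_convolution_powR_le hp hq t0 M0 C0 KMt (bK t t0) yCt) _.
  rewrite (@powRD _ t (1 - p) (- q)); last by rewrite (gt_eqF t0) implybT.
  rewrite -[leRHS]mulrA -[in leRHS](mulrA (beta_const p q)).
  rewrite ler_wpM2l ?mulr_ge0// ler_wpM2l// ler_wpM2r ?powR_ge0//.
  by apply: ge0_ler_powR; rewrite ?nnegrE; [rewrite subr_ge0|..]; exact: ltW || exact: tT.
- move=> t t0 r tr rt; have [N hN] := cvg_tail_le rt.
  rewrite -(cvg_shiftn N); have T0 : 0 < t + 1 by rewrite addr_gt0.
  have [C C0 yC] := wy (t + 1) T0.
  apply: (right_continuous_convolution_bounded hK hp hq C0 t0 (myT (t + 1))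
    (r := fun k => r (k + N)%N)) => //.
  + by move=> x /andP[x0 xt]; apply: yC => //; exact: ltW.
  + by move=> k; rewrite tr hN.
  + by rewrite (cvg_shiftn N).
Qed.

End Volterra.

(** * Existence for Volterra equations *)
Section Picard.
Variable R : realType.
Local Notation mu := (@lebesgue_measure R).
Implicit Types V : completeNormedModType R.

Lemma common_kernel_bound (n : nat) (U : 'I_n -> normedModType R) (V : normedModType R)
    (K : forall i, R -> U i -> V) (p : 'I_n -> R) (T : R) :
  (forall i, singular_kernel (K i) (p i)) -> 0 < T ->
  exists2 M, 0 <= M & forall i, kernel_bound (K i) (p i) T M.
Proof.
move=> hK T0.
have /choice[M hM] : forall i, exists M, 0 <= M /\ kernel_bound (K i) (p i) T M.
  by move=> i; have [_ /(_ T T0)[M M0 KM] _] := hK i; exists M.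
exists (\sum_i M i); first by apply: sumr_ge0 => i _; case: (hM i).
move=> i s x s0 sT; apply: le_trans ((hM i).2 s x s0 sT) _.
rewrite !ler_wpM2r ?powR_ge0// (bigD1 i)//= lerDl.
by apply: sumr_ge0 => j _; case: (hM j).
Qed.

Definition volterra_class V (q : R) (u : R -> V) : Prop :=
  right_continuous u /\ locally_weighted q u.

Lemma volterra_class_bochner V (K : R -> V -> V) (p q : R) (u : R -> V) :
  singular_kernel K p -> 0 <= p < 1 -> 0 <= q < 1 -> volterra_class q u ->
  volterra_class q (convolution K u) /\
  forall t, 0 < t -> is_bochner `]0, t[ (fun x => K (t - x) (u x)) (convolution K u t).
Proof.
move=> hK hp hq [cu wu].
have mu_ := right_continuous_strongly_measurable cu.
by have [h1 [h2 h3]] := convolution_locally_weighted hK hp hq mu_ wu.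
Qed.

Lemma volterra_classD V (q : R) (u v : R -> V) :
  volterra_class q u -> volterra_class q v -> volterra_class q (fun t => u t + v t).
Proof.
move=> [cu wu] [cv wv]; split.
  by move=> t t0 r tr rt; apply: cvgD; [exact: cu|exact: cv].
move=> T T0; have [C C0 uC] := wu T T0; have [C' C'0 vC] := wv T T0.
exists (C + C'); first exact: addr_ge0.
move=> x x0 xT; apply: le_trans (ler_normD _ _) _.
by rewrite mulrDl lerD ?uC ?vC.
Qed.

Lemma volterra_class0 V (q : R) : volterra_class q (fun=> 0 : V).
Proof.
split; first by move=> t t0 r _ _; exact: cvg_cst.
by move=> T T0; exists 0 => // x _ _; rewrite normr0 mul0r.
Qed.

Lemma volterra_class_sum V (n : nat) (q : R) (u : 'I_n -> R -> V) :
  (forall i, volterra_class q (u i)) -> volterra_class q (fun t => \sum_i u i t).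
Proof.
move=> hu; elim: n u hu => [|n IH] u hu.
  by under eq_fun => t do rewrite big_ord0; exact: volterra_class0.
under eq_fun => t do rewrite big_ord_recl.
by apply: volterra_classD => //; apply: IH => i; exact: hu.
Qed.

Lemma sum_norm_convolution_le (n : nat) (U : 'I_n -> normedModType R)
    (V : normedModType R) (K : forall i, R -> U i -> V) (y : forall i, R -> U i)
    (M T p q l e A : R) : 0 <= M -> 0 <= A ->
  (forall i, kernel_bound (K i) p T M) ->
  (forall a t, 0 <= a -> 0 < t -> t <= T ->
    (\int[mu]_(x in `]0%R, t[) (M * ((t - x) `^ (- p) * (a * weight q l x)))%R%:E <=
     (e * (a * weight q l t))%R%:E)%E) ->
  (forall i x, 0 < x -> x <= T -> `|y i x| <= A * weight q l x) ->
  forall t, 0 < t -> t <= T ->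
  (forall i, is_bochner `]0, t[ (fun x => K i (t - x) (y i x))
    (convolution (K i) (y i) t)) ->
  `|\sum_i convolution (K i) (y i) t| <= n%:R * e * (A * weight q l t).
Proof.
move=> M0 A0 KM He yA t t0 tT bK.
apply: le_trans (ler_norm_sum _ _ _) _.
have -> : n%:R * e * (A * weight q l t) = \sum_(i < n) e * (A * weight q l t).
  by rewrite sumr_const card_ord mulr_natl mulrnAl.
apply: ler_sum => i _; rewrite -lee_fin.
apply: le_trans (He A t A0 t0 tT); apply: norm_convolution_le => //.
  by move=> s x s0 st; apply: KM => //; exact: le_trans tT.
by move=> x /andP[x0 xt]; apply: yA => //; exact: le_trans (ltW xt) tT.
Qed.

(** Picard iteration from zero.  On every [(0, T]] the differences of consecutive
    iterates decrease geometrically for the weight attached to [T], so the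
    iterates converge pointwise on [(0, +oo)], uniformly on compact subsets;
    right continuity passes to the limit. *)
Lemma volterra_solution V (n : nat) (k : 'I_n -> R -> V -> V) (p q : R)
    (a : R -> V) : (forall i, singular_kernel (k i) p) ->
  0 <= p < 1 -> 0 <= q < 1 -> volterra_class q a ->
  exists2 u, volterra_class q u &
    forall t, 0 < t -> u t = a t + \sum_i convolution (k i) u t.
Proof.
move=> hk hp hq ha.
pose Phi (u : R -> V) t := a t + \sum_i convolution (k i) u t.
have Phi_class u : volterra_class q u -> volterra_class q (Phi u).
  move=> hu; apply: volterra_classD => //; apply: volterra_class_sum => i.
  by have [] := volterra_class_bochner (hk i) hp hq hu.
have Phi_half T : 0 < T -> exists2 l, 0 < l & forall u v A,
    volterra_class q u -> volterra_class q v -> 0 <= A ->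
    (forall x, 0 < x -> x <= T -> `|u x - v x| <= A * weight q l x) ->
    forall x, 0 < x -> x <= T -> `|Phi u x - Phi v x| <= A / 2 * weight q l x.
  move=> T0; have [M M0 KM] := common_kernel_bound hk T0.
  (* The factor [n + 1] makes up for the sum over the [n] kernels. *)
  pose e : R := (2 * n.+1%:R)^-1.
  have e0 : 0 < e by rewrite invr_gt0 mulr_gt0// ltr0n.
  have [l l0 He] := weighted_kernel_contraction M0 T0 hp hq e0.
  exists l => // u v A hu hv A0 uvA t t0 tT.
  rewrite /Phi opprD addrACA subrr add0r -sumrB.
  have bB i := convolutionB (hk i) ((volterra_class_bochner (hk i) hp hq hu).2 t t0)
    ((volterra_class_bochner (hk i) hp hq hv).2 t t0).
  under eq_bigr => i _ do rewrite -(bB i).2.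
  apply: le_trans (sum_norm_convolution_le M0 A0 KM He _ t0 tT _) _.
  - by move=> i x; exact: uvA.
  - by move=> i; exact: (bB i).1.
  rewrite (_ : A / 2 * _ = 2^-1 * (A * weight q l t)); last by ring.
  rewrite ler_wpM2r ?(mulr_ge0 A0 (ltW (weight_gt0 q l t0)))//.
  rewrite /e invfM mulrCA -[leRHS]mulr1 ler_wpM2l ?invr_ge0//.
  by rewrite ler_pdivrMr ?ltr0n// mul1r ler_nat.
pose u_ m := iter m Phi (fun=> 0).
have u_class m : volterra_class q (u_ m).
  by elim: m => [|m IH]; [exact: volterra_class0|exact: Phi_class].
have u_cauchy T : 0 < T -> exists l C, [/\ 0 < l, 0 <= C,
    (forall u v A, volterra_class q u -> volterra_class q v -> 0 <= A ->
    (forall x, 0 < x -> x <= T -> `|u x - v x| <= A * weight q l x) ->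
    forall x, 0 < x -> x <= T -> `|Phi u x - Phi v x| <= A / 2 * weight q l x) &
    forall m j x, 0 < x -> x <= T ->
      `|u_ (m + j)%N x - u_ m x| <= C * 2^-1 ^+ m * weight q l x].
  move=> T0; have [l l0 Hl] := Phi_half T T0.
  have [C C0 HC] := (u_class 1%N).2 T T0.
  have step m x : 0 < x -> x <= T ->
      `|u_ m.+1 x - u_ m x| <= C * 2^-1 ^+ m * weight q l x.
    elim: m x => [|m IH] x x0 xT.
      rewrite [u_ 0%N]/= subr0 expr0 mulr1; apply: le_trans (HC x x0 xT) _.
      by rewrite ler_wpM2l// powR_le_weight// ltW.
    rewrite exprSr [C * (_ * _)]mulrA; apply: (Hl (u_ m.+1) (u_ m)) => //.
    by rewrite mulr_ge0// exprn_ge0// invr_ge0.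
  exists l, (2 * C); split => //; first by rewrite mulr_ge0.
  move=> m j x x0 xT; have w0 := ltW (weight_gt0 q l x0).
  apply: (@le_trans _ _ (2 * C * (2^-1 ^+ m - 2^-1 ^+ (m + j)) * weight q l x)).
    elim: j => [|j IH].
      by rewrite addn0 !subrr normr0 mulr0 mul0r.
    rewrite -[u_ (m + j.+1)%N x](subrK (u_ (m + j)%N x)) -addrA.
    apply: le_trans (ler_normD _ _) _; rewrite addnS.
    apply: le_trans (lerD (step (m + j)%N x x0 xT) IH) _.
    rewrite exprSr -mulrDl ler_wpM2r//.
    by rewrite le_eqVlt; apply/orP; left; apply/eqP; field.
  rewrite ler_wpM2r// ler_wpM2l ?mulr_ge0// gerBl.
  by rewrite exprn_ge0// invr_ge0.
have c2 : (fun m : nat => (2^-1 : R) ^+ m) @ \oo --> 0.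
  by apply: cvg_expr; rewrite ger0_norm ?invr_ge0// invf_lt1// ltr1n.
pose u t := lim (u_ ^~ t @ \oo).
have u_cvg t : 0 < t -> u_ ^~ t @ \oo --> u t.
  move=> t0; have [l [C [l0 C0 _ H]]] := u_cauchy t t0.
  apply: (@cvg_of_dist_bound _ _ _ (fun m => C * 2^-1 ^+ m * weight q l t)).
    have aux m j : (m <= j)%N -> `|u_ j t - u_ m t| <= C * 2^-1 ^+ m * weight q l t.
      by move=> mj; have := H m (j - m)%N t t0 (lexx t); rewrite subnKC.
    have e0 m : 0 <= C * 2^-1 ^+ m * weight q l t.
      apply: mulr_ge0; last exact: ltW (weight_gt0 _ _ t0).
      by rewrite mulr_ge0// exprn_ge0// invr_ge0.
    move=> m j; have [mj|jm] := leqP m j.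
      by rewrite distrC; apply: ler_wpDr => //; exact: aux.
    by apply: ler_wpDl => //; apply: aux; exact: ltnW.
  rewrite -(mul0r (weight q l t)) -(mulr0 C).
  by apply: cvgMl; apply: cvgMr.
have u_dist T : 0 < T -> exists l C, [/\ 0 < l, 0 <= C,
    (forall u v A, volterra_class q u -> volterra_class q v -> 0 <= A ->
    (forall x, 0 < x -> x <= T -> `|u x - v x| <= A * weight q l x) ->
    forall x, 0 < x -> x <= T -> `|Phi u x - Phi v x| <= A / 2 * weight q l x) &
    forall m x, 0 < x -> x <= T ->
      `|u x - u_ m x| <= C * 2^-1 ^+ m * weight q l x].
  move=> T0; have [l [C [l0 C0 HP H]]] := u_cauchy T T0.
  exists l, C; split => // m x x0 xT.
  have cx : (fun j => `|u_ (j + m)%N x - u_ m x|) @ \oo --> `|u x - u_ m x|.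
    apply: cvg_norm; apply: cvgB; last exact: cvg_cst.
    by rewrite (cvg_shiftn m (u_ ^~ x)); exact: u_cvg.
  apply: cvgr_to_le cx _; apply: nearW => j.
  by rewrite addnC; exact: H.
have hu : volterra_class q u.
  split=> [t t0 r tr rt|T T0]; last first.
    have [l [C [l0 C0 _ H]]] := u_dist T T0.
    exists (C * expR (l * T)); first by rewrite mulr_ge0// expR_ge0.
    move=> x x0 xT; have := H 0%N x x0 xT; rewrite subr0 expr0 mulr1.
    move=> /le_trans; apply; rewrite -mulrA ler_wpM2l//.
    by rewrite weight_le_powR// ltW.
  have T0 : 0 < t + 1 by rewrite addr_gt0.
  have [l [C [l0 C0 _ H]]] := u_dist _ T0.
  pose W := expR (l * (t + 1)) * t `^ (- q).
  have HW m x : t <= x -> x <= t + 1 -> `|u x - u_ m x| <= C * 2^-1 ^+ m * W.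
    move=> tx xT; have x0 := lt_le_trans t0 tx; apply: le_trans (H m x x0 xT) _.
    rewrite ler_wpM2l ?mulr_ge0 ?exprn_ge0 ?invr_ge0//.
    apply: le_trans (weight_le_powR _ (ltW l0) x0 xT) _.
    by rewrite /W ler_wpM2l ?expR_ge0// ler_powRN//; case/andP: hq.
  have cW : (fun m => C * 2^-1 ^+ m * W) @ \oo --> 0.
    by rewrite -(mul0r W) -(mulr0 C); apply: cvgMl; apply: cvgMr.
  apply/cvgrPdist_le => eps eps0; have e3 : 0 < eps / 3 by rewrite divr_gt0.
  have /cvgrPdist_le/(_ _ e3)[m _ /(_ m (leqnn m))] := cW.
  rewrite sub0r normrN => /(le_trans (ler_norm _)) hm.
  have /cvgrPdist_le/(_ _ e3) hc := (u_class m).1 t t0 r tr rt.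
  have /cvgrPdist_le/(_ _ ltr01) hr := rt.
  near=> j; rewrite /=.
  have rj : r j <= t + 1.
    have : `|t - r j| <= 1 by near: j.
    by rewrite ler_distlC => /andP[_].
  have uj : `|u_ m t - u_ m (r j)| <= eps / 3 by near: j.
  rewrite (_ : u t - u (r j) = (u t - u_ m t) + (u_ m t - u_ m (r j)) +
    (u_ m (r j) - u (r j))); last by rewrite !addrA !subrK.
  rewrite (_ : eps = eps / 3 + eps / 3 + eps / 3); last by field.
  apply: le_trans (ler_normD _ _) _; apply: lerD.
    apply: le_trans (ler_normD _ _) _; apply: lerD => //.
    by apply: le_trans (HW _ _ _ _) hm; rewrite ?lerDl.
  rewrite distrC; apply: le_trans (HW _ _ _ _) hm => //.
  exact: ltW (tr j).
exists u => // t t0.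
have [l [C [l0 C0 HP H]]] := u_dist t t0.
apply/eqP; rewrite -subr_eq0 -normr_le0.
have w0 := ltW (weight_gt0 q l t0).
have cE : (fun m => (C * 2^-1 ^+ m.+1 + C * 2^-1 ^+ m / 2) * weight q l t) @ \oo
    --> (C * 0 + C * 0 / 2) * weight q l t.
  apply: cvgMl; apply: cvgD; first by apply: cvgMr; rewrite (cvg_shiftS (fun m => (2^-1 : R) ^+ m)).
  by apply: cvgMl; apply: cvgMr.
rewrite !mulr0 mul0r addr0 mul0r in cE.
apply: cvgr_to_ge cE _; apply: nearW => m.
rewrite -(subrK (u_ m.+1 t) (u t)) -addrA; apply: le_trans (ler_normD _ _) _.
rewrite mulrDl lerD//; first exact: H.
rewrite distrC; apply: (HP u (u_ m)) => //; first by rewrite mulr_ge0// exprn_ge0// invr_ge0.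
by move=> x x0 xt; exact: H.
Unshelve. all: by end_near. Qed.

End Picard.

(** * Smoothing operators of a scale as singular kernels *)
Section ScaleKernels.
Variables (R : realType) (X : banach_scale R).
Local Notation mu := (@lebesgue_measure R).
Implicit Types g a b : idx X.

(** On bounded time intervals a stronger singularity is a weaker requirement.
    This allows for one exponent common to all kernels. *)
Lemma singular_kernel_le (U V : normedModType R) (K : R -> U -> V) (p p' : R) :
  p <= p' -> singular_kernel K p -> singular_kernel K p'.
Proof.
move=> pp' [KB Kb Kc]; split => // T T0; have [M M0 KM] := Kb T T0.
exists (M * T `^ (p' - p)); first by rewrite mulr_ge0// powR_ge0.
move=> s x s0 sT; apply: le_trans (KM s x s0 sT) _.
rewrite ler_wpM2r// -mulrA ler_wpM2l//.
have -> : s `^ (- p) = s `^ (p' - p) * s `^ (- p').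
  rewrite -powRD; last by rewrite (gt_eqF s0) implybT.
  by congr (_ `^ _); ring.
rewrite ler_wpM2r ?powR_ge0//.
by apply: ge0_ler_powR; rewrite ?nnegrE ?subr_ge0// ltW//; exact: lt_le_trans sT.
Qed.

Lemma scale_norm_emb g (z : bspace g) : scale_norm g (emb g z) = `|z|%:E.
Proof.
rewrite /scale_norm (_ : emb g @^-1` [set emb g z] = [set z]).
  by rewrite image_set1 ereal_inf1.
by apply/seteqP; split=> x /= => [/emb_inj|->].
Qed.

(** A finite norm means that [e] belongs to the space, as the infimum of the
    empty set is [+oo]. *)
Lemma scale_norm_leP g (e : ambient X) (c : R) :
  (scale_norm g e <= c%:E)%E -> exists2 z, emb g z = e & `|z| <= c.
Proof.
have [[z ez]|ne] := pselect (exists z, emb g z = e).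
  by rewrite -ez scale_norm_emb lee_fin => zc; exists z.
rewrite /scale_norm (_ : emb g @^-1` [set e] = set0).
  by rewrite image_set0 ereal_inf0 leye_eq.
by apply/seteqP; split=> x //= ex; apply: ne; exists x.
Qed.

Lemma in_spaceK g (z : bspace g) : in_space g (emb g z) = z.
Proof. by apply: xget_unique => //= y /emb_inj. Qed.

Lemma op_norm_ubound (V : normedModType R) (W : Type) (N : W -> \bar R) (f : V -> W) x :
  `|x| <= 1 -> (N (f x) <= op_norm N f)%E.
Proof. by move=> x1; apply: ereal_sup_ubound; exists x. Qed.

Lemma op_norm_scaleP g a (f : {linear bspace g -> ambient X}) (c : R) :
  (op_norm (scale_norm a) f <= c%:E)%E ->
  forall x, exists2 z, emb a z = f x & `|z| <= c * `|x|.
Proof.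
move=> fc x; have [->|x0] := eqVneq x 0.
  by exists 0; rewrite ?linear0 ?normr0 ?mulr0.
have nx0 : `|x| != 0 by rewrite normr_eq0.
pose y := `|x|^-1 *: x.
have y1 : `|y| <= 1 by rewrite normrZ normfV normr_id mulVf.
have [z ez zc] := scale_norm_leP (le_trans (op_norm_ubound (scale_norm a) f y1) fc).
exists (`|x| *: z); last by rewrite normrZ normr_id mulrC ler_wpM2r.
by rewrite linearZ/= ez /y linearZ/= scalerA divff// scale1r.
Qed.

Lemma bop_norm_le (V W : normedModType R) (f : V -> W) (c : R) :
  (forall (k : R) x, f (k *: x) = k *: f x) -> (bop_norm f <= c%:E)%E ->
  forall x, `|f x| <= c * `|x|.
Proof.
move=> fZ fc x; have [->|x0] := eqVneq x 0.
  have -> : f 0 = 0 by rewrite -(scale0r (0 : V)) fZ scale0r.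
  by rewrite !normr0 mulr0.
have nx0 : `|x| != 0 by rewrite normr_eq0.
have y1 : `| `|x|^-1 *: x | <= 1 by rewrite normrZ normfV normr_id mulVf.
have := le_trans (op_norm_ubound (fun y => `|y|%:E) f y1) fc.
rewrite lee_fin fZ normrZ normfV normr_id mulrC ler_pdivrMr//.
by rewrite normr_gt0.
Qed.

Variable S : op_family X.

Definition scale_kernel g a (t : R) (x : bspace g) : bspace a :=
  in_space a (S t g x).

Lemma smoothing_bound g a : smoothing S g a -> forall T, 0 < T ->
  exists2 M, 0 <= M & forall t (x : bspace g), 0 < t -> t <= T ->
    exists2 z, emb a z = S t g x & `|z| <= M * t `^ (- dreg a g) * `|x|.
Proof.
move=> [_ [M [_ HM]]] T T0; exists `|M T| => // t x t0 tT.
have [z ez zM] := op_norm_scaleP (HM T t t0 tT) x; exists z => //.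
by apply: le_trans zM _; rewrite !ler_wpM2r ?powR_ge0 ?ler_norm.
Qed.

Lemma emb_scale_kernel g a t (x : bspace g) : smoothing S g a -> 0 < t ->
  emb a (scale_kernel a t x) = S t g x.
Proof.
move=> hs t0; have [M M0 HM] := smoothing_bound hs t0.
by have [z ez _] := HM t x t0 (lexx t); rewrite /scale_kernel -ez in_spaceK.
Qed.

Lemma scale_kernel_bound g a : smoothing S g a -> forall T, 0 < T ->
  exists2 M, 0 <= M & kernel_bound (@scale_kernel g a) (dreg a g) T M.
Proof.
move=> hs T T0; have [M M0 HM] := smoothing_bound hs T0.
exists M => // t x t0 tT; have [z ez zM] := HM t x t0 tT.
by rewrite /scale_kernel -ez in_spaceK.
Qed.

Lemma scale_kernel_singular g a : smoothing_cont S g a ->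
  singular_kernel (@scale_kernel g a) (dreg a g).
Proof.
move=> [hs hc]; split.
- move=> t x y t0; apply: (@emb_inj _ _ a).
  by rewrite linearB/= !emb_scale_kernel// linearB.
- exact: scale_kernel_bound.
- move=> x s r s0 rs; have := hc x.
  rewrite continuous_open_subspace; last exact: rray_open.
  move=> /(_ s); rewrite inE /= in_itv/= s0 => /(_ isT) cs.
  exact: (cvg_comp _ _ rs cs).
Qed.

(** Both integrals are limits of integrals of simple functions built on the same
    data, hence representing the same elements; topological consistency
    identifies the limits. *)
Lemma convolution_consistent g a b (y : R -> bspace g) (q C t : R) :
  smoothing_cont S g a -> smoothing_cont S g b ->
  0 <= dreg a g < 1 -> 0 <= dreg b g < 1 -> 0 <= q < 1 -> 0 < t ->
  strongly_measurable `]0, t[ y ->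
  (forall x, 0 < x < t -> `|y x| <= C * x `^ (- q)) ->
  emb a (convolution (@scale_kernel g a) y t) =
  emb b (convolution (@scale_kernel g b) y t).
Proof.
move=> ha hb da db hq t0 my yC; have /andP[q0 q1] := hq.
pose C' := `|C| + 1; have C'0 : 0 < C' by rewrite /C' ltr_wpDl.
have yC' x : 0 < x < t -> `|y x| <= C' * x `^ (- q).
  move=> xt; apply: le_trans (yC x xt) _; rewrite ler_wpM2r ?powR_ge0//.
  by rewrite /C' (le_trans (ler_norm C))// lerDl.
have [d [h1 h2 h3 h4 h5]] := approximation_by_simple_data q0 C'0 my yC'.
have [_ ca] := convolution_cvg_simple_data (scale_kernel_singular ha) da hq (ltW C'0) t0 h1 h2 h3 h4 h5.
have [_ cb] := convolution_cvg_simple_data (scale_kernel_singular hb) db hq (ltW C'0) t0 h1 h2 h3 h4 h5.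
apply: topologically_consistent ca cb => k.
have mD : measurable (`]0, t[%classic : set R) by exact: measurable_itv.
have fD := lebesgue_measure_oo_lty t.
rewrite !(simple_integral_comp mD fD _ (h1 k)) !linear_sum; apply: eq_bigr => e _ /=.
rewrite !linearZ/=.
(* A value not attained on [(0, t)] may involve a negative time, but has measure
   zero. *)
have [[x [xt dx]]|ne] := pselect (exists x, 0 < x < t /\ d k x = e).
  have te : 0 < t - e.1.
    rewrite subr_gt0 -dx; have /andP[_ h] := h2 k x xt.
    by apply: le_lt_trans h _; case/andP: xt.
  by rewrite !emb_scale_kernel//; [case: hb|case: ha].
rewrite (_ : `]0, t[%classic `&` _ = set0) ?measure0 ?scale0r//.
apply/seteqP; split => x // [/=]; rewrite in_itv/= => xt dx.
by apply: ne; exists x.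
Qed.

End ScaleKernels.

(** * Perturbed solutions and their differences *)
Section PerturbedFamilies.
Variables (R : realType) (X : banach_scale R) (S : op_family X).
Local Notation mu := (@lebesgue_measure R).

Lemma cvg_bounded_linear (U V : normedModType R) (f : {linear U -> V}) (c : R)
    (x : nat -> U) (x0 : U) : (forall z, `|f z| <= c * `|z|) ->
  x @ \oo --> x0 -> (fun k => f (x k)) @ \oo --> f x0.
Proof.
move=> fc cx; apply/subr_cvg0.
apply: (norm_le_cvg0 (u := fun k => (c * `|x k - x0|)%:E)).
  by move=> k; rewrite lee_fin -linearB fc.
apply: cvg_EFin; first exact: nearW.
rewrite -(mulr0 c); apply: cvgMr.
by apply/norm_cvg0P/subr_cvg0.
Qed.

Lemma Linfty_loc_weighted (a : idx X) (q : R) (u : R -> bspace a) :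
  Linfty_loc q u <-> strongly_measurable `]0, +oo[ u /\ locally_weighted q u.
Proof.
split=> -[mu_ hu]; split => // T T0.
- have {}hu := hu T T0; set A := [set _ | _ in _] in hu.
  have ubT : (((T `^ q * `|u T|)%R)%:E <= ereal_sup A)%E.
    by apply: ereal_sup_ubound; exists T => //=; rewrite T0 lexx.
  have fA : ereal_sup A \is a fin_num.
    by rewrite ge0_fin_numE//; apply: le_trans ubT; rewrite lee_fin mulr_ge0 ?powR_ge0.
  exists (fine (ereal_sup A)).
    by rewrite fine_ge0//; apply: le_trans ubT; rewrite lee_fin mulr_ge0 ?powR_ge0.
  move=> x x0 xT; rewrite powRN ler_pdivlMr ?powR_gt0// mulrC -lee_fin fineK//.
  by apply: ereal_sup_ubound; exists x => //=; rewrite x0.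
- have [C C0 uC] := hu T T0; apply: le_lt_trans (ltry C).
  apply: ge_ereal_sup => _ [x /= /andP[x0 xT] <-]; rewrite lee_fin mulrC.
  by rewrite -ler_pdivlMr ?powR_gt0// -powRN uC.
Qed.

Variables (n : nat) (alpha : idx X) (beta : 'I_n -> idx X) (gamma : idx X).
Hypothesis hgamma : E_set S alpha gamma.
Hypothesis hadm : forall i, admissible S alpha (beta i).

Let q := dreg alpha gamma.
Let K i := @scale_kernel R X S (beta i) alpha.

Lemma dreg_E_set : 0 <= q < 1.
Proof.
have [/andP[h1 h2] _] := hgamma; rewrite /q /dreg; apply/andP; split; lra.
Qed.

Lemma common_exponent : exists2 p : R, 0 <= p < 1 & forall i, singular_kernel (@K i) p.
Proof.
exists (\big[Num.max/0]_(i < n) dreg alpha (beta i)).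
  apply/andP; split; first exact: bigmax_ge_id.
  by apply: bigmax_lt => // i _; have [/andP[]] := hadm i.
move=> i; have [_ hs] := hadm i.
by apply: singular_kernel_le (scale_kernel_singular hs); exact: le_bigmax.
Qed.

Lemma perturbation_bound (R0 : R) (P : forall i, {linear bspace alpha -> bspace (beta i)}) :
  perturbations S R0 P -> forall i x, `|P i x| <= R0 * `|x|.
Proof.
move=> hP i x; have [_ hn] := hP i; apply: bop_norm_le hn x => k x.
by rewrite linearZ.
Qed.

(** The operators [S(s) P_i] form singular kernels on [X^alpha], and
    [S(t) u0] is continuous in [X^alpha] for [t > 0]. *)
Lemma perturbed_solution_exists (R0 : R)
    (P : forall i, {linear bspace alpha -> bspace (beta i)}) (u0 : bspace gamma) :
  0 <= R0 -> (forall i x, `|P i x| <= R0 * `|x|) -> exists u, perturbed_solution S P u0 u.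
Proof.
move=> R00 hP; have [p hp hK] := common_exponent; have [_ hg] := hgamma.
have [_ Kgb Kgc] := scale_kernel_singular hg.
have hk i : singular_kernel (fun s x => K s (P i x)) p.
  have [KB Kb Kc] := hK i; split.
  - by move=> s x y s0; rewrite linearB KB.
  - move=> T T0; have [M M0 KM] := Kb T T0; exists (M * R0); first exact: mulr_ge0.
    move=> s x s0 sT; apply: le_trans (KM _ _ s0 sT) _.
    rewrite (_ : M * R0 * _ * _ = M * s `^ (- p) * (R0 * `|x|)); last by ring.
    by apply: ler_wpM2l; [rewrite mulr_ge0 ?powR_ge0|exact: hP].
  - by move=> x s r s0 rs; exact: Kc.
have ha : volterra_class q (fun t => scale_kernel S alpha t u0).
  split; first by move=> t t0 r _ rt; exact: Kgc.
  move=> T T0; have [M M0 KM] := Kgb T T0.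
  exists (M * `|u0|); first exact: mulr_ge0.
  by move=> x x0 xT; rewrite mulrAC; exact: KM.
have [u [cu wu] hu] := volterra_solution hk hp dreg_E_set ha.
exists u; split; last exact: hu.
apply/Linfty_loc_weighted; split => //.
exact: right_continuous_strongly_measurable.
Qed.

Lemma perturbed_familyE (R0 : R)
    (P : forall i, {linear bspace alpha -> bspace (beta i)}) (u0 : bspace gamma) :
  0 <= R0 -> (forall i x, `|P i x| <= R0 * `|x|) ->
  exists2 u, perturbed_solution S P u0 u &
    forall t, 0 < t -> perturbed_family S P t gamma u0 = emb alpha (u t).
Proof.
move=> R00 hP; exists (xget (fun=> 0) [set u | perturbed_solution S P u0 u]).
  exact: (xgetPex (fun=> 0) (perturbed_solution_exists u0 R00 hP)).
by move=> t t0; rewrite /perturbed_family t0.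
Qed.

Section two_perturbations.
Variables (R0 : R) (P Q : forall i, {linear bspace alpha -> bspace (beta i)}).
Hypotheses (hP : forall i x, `|P i x| <= R0 * `|x|)
  (hQ : forall i x, `|Q i x| <= R0 * `|x|).
Variables (u0 v0 : bspace gamma) (u v : R -> bspace alpha).
Hypotheses (hR0 : 0 <= R0)
  (hu : perturbed_solution S P u0 u) (hv : perturbed_solution S Q v0 v).

(** The difference of the two integrands before [S(t - x)] is applied, with
    values in [X^(beta_i)]. *)
Definition forcing_difference i : R -> bspace (beta i) :=
  (fun x => P i (u x)) \- (fun x => Q i (v x)).

Lemma forced_term i (L : {linear bspace alpha -> bspace (beta i)}) (w : R -> bspace alpha) :
  (forall x, `|L x| <= R0 * `|x|) -> Linfty_loc q w ->
  strongly_measurable `]0, +oo[ (fun x => L (w x)) /\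
  locally_weighted q (fun x => L (w x)).
Proof.
move=> hL /Linfty_loc_weighted[mw ww]; split.
  apply: (strongly_measurable_comp2 (h := fun x _ : bspace alpha => L x) _ mw mw).
  by move=> x _ x0 _ cx _; exact: cvg_bounded_linear cx.
move=> T T0; have [C C0 wC] := ww T T0; exists (R0 * C); first exact: mulr_ge0.
move=> x x0 xT; apply: le_trans (hL _) _.
by rewrite -mulrA ler_wpM2l// wC.
Qed.

Lemma forcing_difference_measurable i :
  strongly_measurable `]0, +oo[ (@forcing_difference i).
Proof.
apply: strongly_measurableB.
- exact: (forced_term (hP i) hu.1).1.
- exact: (forced_term (hQ i) hv.1).1.
Qed.

Lemma forcing_difference_bochner i t : 0 < t ->
  is_bochner `]0, t[ (fun x => K (t - x) (@forcing_difference i x))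
    (convolution (@K i) (@forcing_difference i) t) /\
  convolution (@K i) (@forcing_difference i) t =
  convolution (@K i) (fun x => P i (u x)) t - convolution (@K i) (fun x => Q i (v x)) t.
Proof.
move=> t0; have [p hp hK] := common_exponent.
have [mP wP] := forced_term (hP i) hu.1; have [mQ wQ] := forced_term (hQ i) hv.1.
have [_ [_ bP]] := convolution_locally_weighted (hK i) hp dreg_E_set mP wP.
have [_ [_ bQ]] := convolution_locally_weighted (hK i) hp dreg_E_set mQ wQ.
exact: (convolutionB (hK i) (bP t t0) (bQ t t0)).
Qed.

Lemma solution_difference t : 0 < t ->
  u t - v t = scale_kernel S alpha t (u0 - v0) +
    \sum_i convolution (@K i) (@forcing_difference i) t.
Proof.
move=> t0; have [_ eu] := hu; have [_ ev] := hv.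
have [_ hg] := hgamma; have [KB _ _] := scale_kernel_singular hg.
rewrite eu// ev// KB// opprD addrACA -sumrB; congr (_ + _).
by apply: eq_bigr => i _; rewrite (forcing_difference_bochner i t0).2.
Qed.
End two_perturbations.

Section gronwall.
Variables (R0 T p M Mg l : R).
Hypotheses (hR0 : 0 <= R0) (hM : 0 <= M) (hMg : 0 <= Mg) (hl : 0 < l)
  (hT : 0 < T).
Let e : R := (2 * n.+1%:R * (R0 + 1))^-1.
Hypotheses (KM : forall i, kernel_bound (@K i) p T M)
  (KMg : kernel_bound (@scale_kernel R X S gamma alpha) q T Mg)
  (He : forall a t, 0 <= a -> 0 < t -> t <= T ->
    (\int[mu]_(x in `]0%R, t[) (M * ((t - x) `^ (- p) * (a * weight q l x)))%R%:E <=
     (e * (a * weight q l t))%R%:E)%E).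

(** The form common to the bound of one solution and of the difference of two:
    [z] satisfies a Volterra equation whose integrands [y i] are controlled by
    [z] up to a known term [B].  The smallness [e] of the kernels absorbs the
    number [n] of integrals and the size [R0] of the perturbations. *)
Lemma equation_gronwall (z : R -> bspace alpha) (z0 : bspace gamma)
    (y : forall i, R -> bspace (beta i)) (B : R) : 0 <= B ->
  locally_weighted q z ->
  (forall t, 0 < t -> z t = scale_kernel S alpha t z0 +
    \sum_i convolution (@K i) (y i) t) ->
  (forall i t, 0 < t -> is_bochner `]0, t[ (fun x => K (t - x) (y i x))
    (convolution (@K i) (y i) t)) ->
  (forall i x, 0 < x -> x <= T -> `|y i x| <= R0 * `|z x| + B * weight q l x) ->
  forall t, 0 < t -> t <= T -> `|z t| <= 2 * (Mg * `|z0| + B / 2) * weight q l t.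
Proof.
move=> B0 wz ez bK yz; have [C C0 zC] := wz T hT.
have G0 : 0 <= Mg * `|z0| by exact: mulr_ge0.
apply: (weighted_gronwall (ltW hl) _ C0 zC); first by rewrite addr_ge0 ?divr_ge0.
move=> A A0 zA t t0 tT; have w0 := ltW (weight_gt0 q l t0).
have A'0 : 0 <= R0 * A + B by rewrite addr_ge0 ?mulr_ge0.
have yA i x : 0 < x -> x <= T -> `|y i x| <= (R0 * A + B) * weight q l x.
  move=> x0 xT; apply: le_trans (yz i x x0 xT) _.
  by rewrite mulrDl lerD2r -mulrA ler_wpM2l// zA.
rewrite ez//; apply: le_trans (ler_normD _ _) _.
apply: le_trans (lerD (KMg _ t0 tT)
  (sum_norm_convolution_le hM A'0 KM He yA t0 tT (fun i => bK i t t0))) _.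
rewrite [leRHS](_ : _ = Mg * `|z0| * weight q l t +
  (B / 2 + A / 2) * weight q l t); last by ring.
apply: lerD.
  by rewrite mulrAC ler_wpM2l// powR_le_weight// ltW.
rewrite mulrA ler_wpM2r//.
have R10 : 0 < R0 + 1 by rewrite ltr_wpDl.
have ne : n%:R * e <= (2 * (R0 + 1))^-1.
  rewrite /e (_ : 2 * n.+1%:R * (R0 + 1) = n.+1%:R * (2 * (R0 + 1))); last by ring.
  rewrite invfM mulrA ler_piMl// ?invr_ge0 ?mulr_ge0 ?(ltW R10)//.
  by rewrite ler_pdivrMr ?ltr0n// mul1r ler_nat.
apply: le_trans (ler_wpM2r A'0 ne) _.
rewrite mulrC ler_pdivrMr ?mulr_gt0//.
rewrite (_ : (B / 2 + A / 2) * _ = R0 * A + B + (A + R0 * B)); last by field.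
by rewrite lerDl addr_ge0 ?mulr_ge0.
Qed.

Lemma solution_bound (Q : forall i, {linear bspace alpha -> bspace (beta i)})
    (v0 : bspace gamma) (v : R -> bspace alpha) :
  (forall i x, `|Q i x| <= R0 * `|x|) -> perturbed_solution S Q v0 v ->
  forall t, 0 < t -> t <= T -> `|v t| <= 2 * Mg * `|v0| * weight q l t.
Proof.
move=> hQ hv t t0 tT; have [/Linfty_loc_weighted[_ wv] ev] := hv.
rewrite (_ : 2 * Mg * _ = 2 * (Mg * `|v0| + 0 / 2)); last by ring.
apply: (equation_gronwall (lexx 0) wv ev) => // [i s s0|i x x0 xT]; last first.
  by rewrite mul0r addr0.
have [p' hp' hK] := common_exponent.
have [mQ wQ] := forced_term hR0 (hQ i) hv.1.
by have [_ [_]] := convolution_locally_weighted (hK i) hp' dreg_E_set mQ wQ; exact.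
Qed.

Lemma solution_difference_bound
    (P Q : forall i, {linear bspace alpha -> bspace (beta i)})
    (u0 v0 : bspace gamma) (u v : R -> bspace alpha) (d : R) : 0 <= d ->
  (forall i x, `|P i x| <= R0 * `|x|) -> (forall i x, `|Q i x| <= R0 * `|x|) ->
  (forall i x, `|P i x - Q i x| <= d * `|x|) ->
  perturbed_solution S P u0 u -> perturbed_solution S Q v0 v ->
  forall t, 0 < t -> t <= T ->
  `|u t - v t| <= 2 * Mg * (`|u0 - v0| + d * `|v0|) * weight q l t /\
  forall i, `|forcing_difference P Q u v i t| <=
    2 * Mg * (R0 + 1) * (`|u0 - v0| + d * `|v0|) * weight q l t.
Proof.
move=> d0 hP hQ hPQ hu hv.
have vb := solution_bound hQ hv.
have [/Linfty_loc_weighted[_ wu] _] := hu; have [/Linfty_loc_weighted[_ wv] _] := hv.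
have fd i x : `|forcing_difference P Q u v i x| <=
    R0 * `|u x - v x| + d * `|v x|.
  rewrite /forcing_difference /=.
  (* The perturbations are compared on [v], which is already bounded. *)
  rewrite (_ : P i (u x) - Q i (v x) = P i (u x - v x) + (P i (v x) - Q i (v x))).
    by apply: le_trans (ler_normD _ _) _; apply: lerD.
  by rewrite linearB addrA subrK.
have fdT i x : 0 < x -> x <= T -> `|forcing_difference P Q u v i x| <=
    R0 * `|u x - v x| + (d * (2 * Mg * `|v0|)) * weight q l x.
  move=> x0 xT; apply: le_trans (fd i x) _; rewrite lerD2l.
  by rewrite -[leRHS]mulrA ler_wpM2l// vb.
have db t : 0 < t -> t <= T ->
    `|u t - v t| <= 2 * Mg * (`|u0 - v0| + d * `|v0|) * weight q l t.
  rewrite (_ : 2 * Mg * _ = 2 * (Mg * `|u0 - v0| + (d * (2 * Mg * `|v0|)) / 2)); last by field.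
  apply: (equation_gronwall (z := fun t => u t - v t)
    (y := forcing_difference P Q u v)) => //.
  - by rewrite !mulr_ge0.
  - move=> T' T'0; have [C C0 uC] := wu T' T'0; have [C' C'0 vC] := wv T' T'0.
    exists (C + C'); first exact: addr_ge0.
    move=> x x0 xT; apply: le_trans (ler_normB _ _) _.
    by rewrite mulrDl lerD ?uC ?vC.
  - by move=> s s0; exact: (solution_difference hP hQ hR0 hu hv s0).
  - by move=> i s s0; have [] := forcing_difference_bochner hP hQ hR0 hu hv i s0.
move=> t t0 tT; split; first exact: db.
move=> i; apply: le_trans (fdT i t t0 tT) _.
have w0 := ltW (weight_gt0 q l t0).
apply: le_trans (lerD (ler_wpM2l hR0 (db t t0 tT)) (lexx _)) _.
rewrite (_ : 2 * Mg * (R0 + 1) * _ * _ = R0 * (2 * Mg * (`|u0 - v0| + d * `|v0|) *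
  weight q l t) + d * (2 * Mg * `|v0|) * weight q l t +
  2 * Mg * `|u0 - v0| * weight q l t); last by ring.
by rewrite lerDl; apply: mulr_ge0 => //; rewrite !mulr_ge0.
Qed.

End gronwall.

End PerturbedFamilies.

(** * Continuous dependence on perturbation and initial value *)
Lemma pert_dist_bound (R : realType) (X : banach_scale R) (n : nat) (alpha : idx X)
    (beta : 'I_n -> idx X) (R0 : R)
    (P Q : forall i, {linear bspace alpha -> bspace (beta i)}) : 0 <= R0 ->
  (forall i x, `|P i x| <= R0 * `|x|) -> (forall i x, `|Q i x| <= R0 * `|x|) ->
  exists d, [/\ 0 <= d, pert_dist P Q = d%:E &
    forall i x, `|P i x - Q i x| <= d * `|x|].
Proof.
move=> R00 hP hQ.
have pd0 : (0 <= pert_dist P Q)%E by exact: bigmax_ge_id.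
have pdR : (pert_dist P Q <= (2 * R0)%:E)%E.
  apply: bigmax_le => [|i _]; first by rewrite lee_fin mulr_ge0.
  apply: ge_ereal_sup => _ [x /= x1 <-]; rewrite lee_fin.
  apply: le_trans (ler_normB _ _) _; apply: le_trans (lerD (hP i x) (hQ i x)) _.
  rewrite (_ : _ + _ = 2 * R0 * `|x|); last by ring.
  by rewrite ler_piMr// mulr_ge0.
have pdf : pert_dist P Q \is a fin_num.
  by rewrite ge0_fin_numE// (le_lt_trans pdR)// ltry.
exists (fine (pert_dist P Q)); split; first exact: fine_ge0.
  by rewrite fineK.
move=> i; apply: bop_norm_le => [k x|]; first by rewrite scalerBr !linearZ.
rewrite fineK//.
exact: (le_bigmax 0%E (fun i : 'I_n => bop_norm (fun x => P i x - Q i x)) i).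
Qed.

Theorem theorem6p12 (R : realType) (X : banach_scale R) (S : op_family X)
  (n : nat) (hn : (0 < n)%N)
  (alpha : idx X) (beta : 'I_n -> idx X) (R0 : R) (hR0 : 0 < R0)
  (gamma : idx X) (hgamma : E_set S alpha gamma)
  (gamma' : idx X) (hgamma' : R_sets S beta gamma')
  (hsmooth : smoothing S gamma gamma')
  (T : R) (hT : 0 < T) :
  (forall R1 : R, exists M0 : R,
    forall P Q : forall i, {linear bspace alpha -> bspace (beta i)},
      perturbations S R0 P -> perturbations S R0 Q ->
    forall u0 v0 : bspace gamma, `|u0| <= R1 -> `|v0| <= R1 ->
    forall t : R, 0 < t -> t <= T ->
      (scale_norm gamma'
         (perturbed_family S P t gamma u0 - perturbed_family S Q t gamma v0)%R
       <= (M0 / t `^ dreg gamma' gamma)%:E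
          * (`|u0 - v0|%:E + pert_dist P Q))%E) /\
  (exists M1 : R,
    forall P Q : forall i, {linear bspace alpha -> bspace (beta i)},
      perturbations S R0 P -> perturbations S R0 Q ->
    forall t : R, 0 < t -> t <= T ->
      (op_norm (scale_norm gamma')
         (fun u0 : bspace gamma =>
            perturbed_family S P t gamma u0 - perturbed_family S Q t gamma u0)%R
       <= (M1 / t `^ dreg gamma' gamma)%:E * pert_dist P Q)%E).
Proof.
have H : forall R1 : R, exists M0 : R,
    forall P Q : forall i, {linear bspace alpha -> bspace (beta i)},
      perturbations S R0 P -> perturbations S R0 Q ->
    forall u0 v0 : bspace gamma, `|u0| <= R1 -> `|v0| <= R1 ->
    forall t : R, 0 < t -> t <= T ->
      (scale_norm gamma'
         (perturbed_family S P t gamma u0 - perturbed_family S Q t gamma v0)%R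
       <= (M0 / t `^ dreg gamma' gamma)%:E
          * (`|u0 - v0|%:E + pert_dist P Q))%E.
  move=> R1.
  (* The constants may only depend on the scale and on [R0], [R1] and [T], and
     admissibility of the indices is known through the perturbations alone. *)
  have [hadm|nadm] := pselect (forall i, admissible S alpha (beta i)); last first.
    by exists 0 => P Q hP; exfalso; apply: nadm => i; case: (hP i).
  have R00 := ltW hR0.
  have hq := dreg_E_set hgamma; set q := dreg alpha gamma in hq *.
  have [p hp hK] := common_exponent hadm.
  have [M M0 KM] := common_kernel_bound hK hT.
  have [Mg Mg0 KMg] := scale_kernel_bound hgamma.2.1 hT.
  have e0 : 0 < (2 * n.+1%:R * (R0 + 1))^-1 :> R.
    by rewrite invr_gt0 !mulr_gt0// ?ltr0n// ltr_wpDl.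
  have [l l0 He] := weighted_kernel_contraction M0 hT hp hq e0.
  have hR i : smoothing_cont S (beta i) gamma' by have [] := hgamma' i Logic.I.
  have hd' i : 0 <= dreg gamma' (beta i) < 1.
    have [/andP[h1 h2] _] := hgamma' i Logic.I.
    by rewrite /dreg subr_ge0 h1 ltrBlDl.
  have [M' M'0 KM'] := common_kernel_bound (fun i => scale_kernel_singular (hR i)) hT.
  have [Mgg Mgg0 KMgg] := smoothing_bound hsmooth hT.
  pose c := 2 * Mg * (R0 + 1) * (1 + `|R1|) * expR (l * T).
  have c0 : 0 <= c.
    by rewrite !mulr_ge0 ?expR_ge0 ?addr_ge0.
  pose b i := M' * c * (beta_const (dreg gamma' (beta i)) q * T `^ (1 - dreg alpha (beta i))).
  have b0 i : 0 <= b i.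
    apply: mulr_ge0; first exact: mulr_ge0.
    apply: mulr_ge0 (powR_ge0 _ _); apply: beta_const_ge0; first by case/andP: (hd' i).
    by case/andP: hq.
  exists (Mgg + \sum_i b i) => P Q hP hQ u0 v0 _ v0R t t0 tT.
  have {}hP := perturbation_bound hP; have {}hQ := perturbation_bound hQ.
  have [d [d0 -> hPQ]] := pert_dist_bound R00 hP hQ.
  have [u hu uE] := perturbed_familyE hgamma hadm u0 R00 hP.
  have [v hv vE] := perturbed_familyE hgamma hadm v0 R00 hQ.
  rewrite uE// vE// -linearB (solution_difference hgamma hadm hP hQ R00 hu hv t0).
  set y := forcing_difference P Q u v.
  pose Delta := `|u0 - v0| + d.
  have Delta0 : 0 <= Delta by exact: addr_ge0.
  have yb i x : 0 < x -> x <= T -> `|y i x| <= c * Delta * x `^ (- q).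
    move=> x0 xT; have [_ /(_ i)] := solution_difference_bound hgamma hadm R00 M0 Mg0 l0 hT
      KM KMg He d0 hP hQ hPQ hu hv x0 xT.
    move=> /le_trans; apply.
    have E0 : 0 <= 2 * Mg * (R0 + 1) * (1 + `|R1|) * Delta by rewrite !mulr_ge0// addr_ge0.
    rewrite (_ : c * Delta * _ = 2 * Mg * (R0 + 1) * (1 + `|R1|) * Delta *
      (expR (l * T) * x `^ (- q))); last by rewrite /c; ring.
    apply: ler_pM.
    - by rewrite !mulr_ge0// addr_ge0// mulr_ge0.
    - exact: ltW (weight_gt0 _ _ x0).
    - rewrite -[leRHS]mulrA ler_wpM2l ?mulr_ge0 ?addr_ge0// /Delta.
      rewrite mulrDl mul1r mulrDr -addrA lerD2l.
      apply: (@le_trans _ _ (`|R1| * d)); last by rewrite addrA lerDr addr_ge0// mulr_ge0.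
      by rewrite mulrC ler_wpM2r// (le_trans v0R)// ler_norm.
    - by rewrite weight_le_powR// ltW.
  have my i : strongly_measurable `]0, t[ (y i).
    have [s [hs sy]] := forcing_difference_measurable hP hQ R00 hu hv i.
    exists s; split => //; apply: aeS sy => x sy.
    by rewrite /= in_itv/= => /andP[x0 _]; apply: sy; rewrite /= in_itv/= x0.
  have ybt i x : 0 < x < t -> `|y i x| <= c * Delta * x `^ (- q).
    by move=> /andP[x0 xt]; apply: yb => //; exact: le_trans (ltW xt) tT.
  have [z ez zM] := KMgg t (u0 - v0) t0 tT.
  rewrite linearD/= emb_scale_kernel//; last by case: hgamma => _ [].
  rewrite -ez linear_sum.
  rewrite (_ : \sum_i _ =
      \sum_i emb gamma' (convolution (scale_kernel S gamma' (g:=beta i)) (y i) t)); last first.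
    apply: eq_bigr => i _.
    exact: (convolution_consistent (hadm i).2 (hR i) (hadm i).1 (hd' i) hq t0 (my i) (ybt i)).
  rewrite -linear_sum -linearD scale_norm_emb -EFinD -EFinM lee_fin.
  have cb i : `|convolution (scale_kernel S gamma' (g:=beta i)) (y i) t| <=
      b i * t `^ (- dreg gamma' gamma) * Delta.
    have KMt : kernel_bound (scale_kernel S gamma' (g:=beta i)) (dreg gamma' (beta i)) t M'.
      by move=> s x s0 st; apply: KM' => //; exact: le_trans tT.
    apply: le_trans (norm_convolution_powR_le (hd' i) hq t0 M'0 (mulr_ge0 c0 Delta0) KMt
      (convolution_is_bochner (scale_kernel_singular (hR i)) (hd' i) hq t0 (my i) (ybt i))
      (ybt i)) _.
    (* The exponent [1 - dreg alpha (beta i)] is positive, so this factor stays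
       bounded on [(0, T]]. *)
    have -> : 1 - dreg gamma' (beta i) - q =
        (1 - dreg alpha (beta i)) + - dreg gamma' gamma.
      by rewrite /q /dreg; ring.
    rewrite powRD; last by rewrite (gt_eqF t0) implybT.
    rewrite (_ : b i * _ * Delta = M' * (c * Delta) * (beta_const (dreg gamma' (beta i)) q *
      (T `^ (1 - dreg alpha (beta i)) * t `^ (- dreg gamma' gamma)))); last by rewrite /b; ring.
    apply: ler_wpM2l; first exact: (mulr_ge0 M'0 (mulr_ge0 c0 Delta0)).
    apply: ler_wpM2l.
      by apply: beta_const_ge0; [case/andP: (hd' i)|case/andP: hq].
    apply: ler_wpM2r (powR_ge0 _ _) _ _ _.
    apply: ge0_ler_powR; rewrite ?nnegrE; [|exact: ltW..|exact: tT].
    by have [/andP[_ h] _] := hadm i; rewrite subr_ge0 ltW.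
  apply: le_trans (ler_normD _ _) _.
  apply: le_trans (lerD zM (ler_norm_sum _ _ _)) _.
  apply: le_trans (lerD (lexx _) (ler_sum _ (fun i _ => cb i))) _.
  rewrite -mulr_suml -mulr_suml powRN -/Delta.
  rewrite (_ : (_ + _) / _ * Delta = Mgg / t `^ dreg gamma' gamma * Delta +
    (\sum_i b i) / t `^ dreg gamma' gamma * Delta); last by ring.
  by rewrite lerD2r ler_wpM2l ?divr_ge0 ?powR_ge0// /Delta lerDl.
split; first exact: H.
have [M1 HM1] := H 1; exists M1 => P Q hP hQ t t0 tT.
apply: ge_ereal_sup => _ [u0 /= u01 <-].
have := HM1 P Q hP hQ u0 u0 u01 u01 t t0 tT.
by rewrite (subrr u0) normr0 add0e; exact.
Qed.
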